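(* For every integer $k\ge1$ and every smooth function $\phi:[-2,2]\to\mathbb{R}$, $$\sum_{l=1}^{2k}\frac{(-1)^{l-1}}{l}\|\partial^{(l-1)}\phi'\|^2_{\alpha^{\otimes l}}\;\le\;\frac12\langle\mathcal{N}\phi,\phi\rangle\;\le\;\sum_{l=1}^{2k-1}\frac{(-1)^{l-1}}{l}\|\partial^{(l-1)}\phi'\|^2_{\alpha^{\otimes l}}.$$ Equality holds in the left inequality for any polynomial $\phi$ of degree $2k$, and equality holds in the right inequality for any polynomial $\phi$ of degree $2k-1$. Also, $$\frac12\langle\mathcal{N}\phi,\phi\rangle=\sum_{l=1}^{\infty}\frac{(-1)^{l-1}}{l}\|\partial^{(l-1)}\phi'\|^2_{\alpha^{\otimes l}}$$ provided the series converges (for instance, this is always the case if $\phi$ is a polynomial).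
   Context: On $[-2,2]$ let $\alpha(dx)=\frac{\sqrt{4-x^2}}{2\pi}dx$ (semicircular law) and $\beta(dx)=\frac{dx}{\pi\sqrt{4-x^2}}$ (arcsine law). $\langle\cdot,\cdot\rangle$ is the inner product of $L^2(\beta)$, and $\|\cdot\|_{\alpha^{\otimes l}}$ is the norm of $L^2(\alpha^{\otimes l})$ on $[-2,2]^l$. For a $C^2$ function $\phi$ on $[-2,2]$, $$(\mathcal{N}\phi)(x)=\int y\phi'(y)\beta(dy)+x\int\phi'(y)\beta(dy)-(4-x^2)\int\frac{\phi'(x)-\phi'(y)}{x-y}\beta(dy).$$ It is known that $\frac12\langle\mathcal{N}\phi,\phi\rangle=\int_{-2}^2\int_{-2}^2\left(\frac{\phi(x)-\phi(y)}{x-y}\right)^2\frac{4-xy}{4\pi^2\sqrt{(4-x^2)(4-y^2)}}\,dx\,dy$. The non-commutative derivative is $(\partial f)(x,y)=\frac{f(x)-f(y)}{x-y}$ (extended by $f'(x)$ on the diagonal). Its higher versions are $\partial^{(0)}=I$, $\partial^{(1)}=\partial$, $\partial^{(k)}=(\partial\otimes I^{\otimes(k-1)})\partial^{(k-1)}$, i.e. $\partial$ is applied in the first variable; thus $\partial^{(k)}f$ is a smooth function of $k+1$ variables on $[-2,2]^{k+1}$ when $f$ is smooth on $[-2,2]$. *)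

(* Defs.v *)
From HB Require Import structures.
From mathcomp Require Import all_boot all_order all_algebra.
From mathcomp Require Import all_classical all_reals all_analysis.
From mathcomp Require Import measurable_realfun.

Set Implicit Arguments.
Unset Strict Implicit.
Unset Printing Implicit Defensive.

Import Order.TTheory GRing.Theory Num.Theory.
Import numFieldNormedType.Exports.

Local Open Scope classical_set_scope.
Local Open Scope ring_scope.

Section density.
Local Open Scope ereal_scope.
Context (R : realType) (f : R -> R).

Definition density_measure (U : set (measurableTypeR R)) : \bar R :=
  \int[lebesgue_measure]_(x in U) (f x)%:E.

Hypothesis mf : measurable_fun setT f.
Hypothesis f0 : forall x, (0 <= f x)%R.

Lemma density_measure0 : density_measure set0 = 0.
Proof. by rewrite /density_measure integral_set0. Qed.

Lemma density_measure_ge0 U : 0 <= density_measure U.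
Proof. by apply: integral_ge0 => x _; rewrite lee_fin. Qed.

Lemma density_measure_sigma_additive : semi_sigma_additive density_measure.
Proof.
move=> /= F mF tF mUF; rewrite /density_measure; apply: cvg_toP.
  apply: ereal_nondecreasing_is_cvgn => m n mn.
  apply: lee_sum_nneg_natr => // k _ _.
  by apply: integral_ge0 => x _; rewrite lee_fin.
rewrite ge0_integral_bigcup//=.
- by apply: measurable_funTS; exact/measurable_EFinP.
- by move=> x _; rewrite lee_fin.
Qed.

Lemma density_measureT_lty (a b c : R) : (a <= b)%R ->
  (forall x, (f x <= c)%R) -> (forall x, x \notin `[a, b] -> f x = 0%R) ->
  density_measure setT < +oo.
Proof.
move=> ab fc fab; rewrite /density_measure.
rewrite (_ : (fun x => _) = (fun x => (f x)%:E) \_ `[a, b]%classic); last first.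
  apply/funext => x; rewrite patchE; case: ifPn => //.
  by rewrite notin_setE/= => /negP xab; rewrite fab.
rewrite -integral_mkcond.
apply: (@le_lt_trans _ _ (\int[lebesgue_measure]_(x in `[a, b]) c%:E)).
  apply: ge0_le_integral => //.
  - by move=> x _; rewrite lee_fin.
  - by apply: measurable_funTS; exact/measurable_EFinP.
  - by move=> x _; rewrite lee_fin.
rewrite integral_cst//= lebesgue_measure_itv/= lte_fin.
by case: ifPn => _; rewrite ?mule0 ?ltry// -EFinD -EFinM ltry.
Qed.

End density.

Section semicircular_arcsine.
Context (R : realType).

Definition semicircular_pdf (x : R) : R :=
  if -2 <= x <= 2 then Num.sqrt (4 - x ^+ 2) / (2 * pi) else 0.

(* At the endpoints the value is 0, by 0^-1 = 0. *)
Definition arcsine_pdf (x : R) : R :=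
  if -2 <= x <= 2 then (pi * Num.sqrt (4 - x ^+ 2))^-1 else 0.

Lemma semicircular_pdf_ge0 x : 0 <= semicircular_pdf x.
Proof.
rewrite /semicircular_pdf; case: ifPn => // _.
by rewrite divr_ge0 ?sqrtr_ge0// mulr_ge0// pi_ge0.
Qed.

Lemma arcsine_pdf_ge0 x : 0 <= arcsine_pdf x.
Proof.
rewrite /arcsine_pdf; case: ifPn => // _.
by rewrite invr_ge0 mulr_ge0 ?sqrtr_ge0// pi_ge0.
Qed.

Let mroot : measurable_fun setT (fun x : R => Num.sqrt (4 - x ^+ 2)).
Proof.
apply: continuous_measurable_fun => x.
apply: continuous_comp; last exact: sqrt_continuous.
by apply: cvgB; [exact: cvg_cst|exact: exprn_continuous].
Qed.

Let mitv : measurable_fun setT (fun x : R => -2 <= x <= 2).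
Proof. by apply: measurable_and => //; exact: measurable_fun_ler. Qed.

Lemma measurable_semicircular_pdf : measurable_fun setT semicircular_pdf.
Proof.
apply: measurable_fun_if => //=.
by apply: measurable_funTS; exact: measurable_funM.
Qed.

Lemma measurable_arcsine_pdf : measurable_fun setT arcsine_pdf.
Proof.
apply: measurable_fun_if => //=; apply: measurable_funTS.
rewrite (_ : (fun x => _) =
  (fun x => (pi * Num.sqrt (4 - x ^+ 2)) `^ (-1))); last first.
  by apply/funext => x; rewrite powR_inv1// mulr_ge0 ?pi_ge0// sqrtr_ge0.
apply: (measurableT_comp (f := @powR R ^~ (-1))).
  exact: measurable_powR.
exact: measurable_funM.
Qed.

Definition semicircular : set (measurableTypeR R) -> \bar R :=
  density_measure semicircular_pdf.

HB.instance Definition _ := isMeasure.Build _ _ _ semicircular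
  (density_measure0 _) (density_measure_ge0 semicircular_pdf_ge0)
  (density_measure_sigma_additive measurable_semicircular_pdf
     semicircular_pdf_ge0).

Lemma semicircular_fin : fin_num_fun semicircular.
Proof.
apply: lty_fin_num_fun; apply: (@density_measureT_lty _ _ measurable_semicircular_pdf
  semicircular_pdf_ge0 (-2) 2 (2 / (2 * pi))).
- by rewrite (@le_trans _ _ 0)// oppr_le0.
- move=> x; rewrite /semicircular_pdf; case: ifPn => _.
    rewrite ler_pM2r ?invr_gt0 ?mulr_gt0 ?pi_gt0//.
    rewrite -[leRHS]ger0_norm// -sqrtr_sqr ler_sqrt ?exprn_ge0//.
    by rewrite -natrX lerBlDr lerDl sqr_ge0.
  by rewrite divr_ge0// mulr_ge0// pi_ge0.
- by move=> x; rewrite in_itv/= /semicircular_pdf => /negbTE ->.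
Qed.

HB.instance Definition _ := Measure_isFinite.Build _ _ _ semicircular
  semicircular_fin.

Definition arcsine : set (measurableTypeR R) -> \bar R :=
  density_measure arcsine_pdf.

HB.instance Definition _ := isMeasure.Build _ _ _ arcsine
  (density_measure0 _) (density_measure_ge0 arcsine_pdf_ge0)
  (density_measure_sigma_additive measurable_arcsine_pdf arcsine_pdf_ge0).

End semicircular_arcsine.
Arguments semicircular {R}.
Arguments arcsine {R}.

Section tuple_measure.
Local Open Scope ereal_scope.
Context d (T : measurableType d) (R : realType).

Section cons.
Context (n : nat) (mu : {finite_measure set T -> \bar R})
  (nu : {finite_measure set (n.-tuple T) -> \bar R}).

Let tcons (p : T * n.-tuple T) : n.+1.-tuple T := [tuple of p.1 :: p.2].

Let mtcons : measurable_fun [set: T * n.-tuple T] tcons.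
Proof. exact: measurable_cons. Qed.

Definition cons_measure : set (n.+1.-tuple T) -> \bar R :=
  pushforward (mu \x nu) (fun p => [tuple of p.1 :: p.2]).

Let m : {measure set _ -> \bar R} :=
  measure_function_pushforward__canonical__measure_function_Measure
    (mu \x nu) mtcons.

Lemma cons_measure0 : cons_measure set0 = 0.
Proof. exact: (measure0 m). Qed.

Lemma cons_measure_ge0 A : 0 <= cons_measure A.
Proof. exact: (measure_ge0 m). Qed.

Lemma cons_measure_sigma_additive : semi_sigma_additive cons_measure.
Proof. exact: (@measure_semi_sigma_additive _ _ _ m). Qed.

HB.instance Definition _ := isMeasure.Build _ _ _ cons_measure
  cons_measure0 cons_measure_ge0 cons_measure_sigma_additive.

Lemma cons_measure_fin : fin_num_fun cons_measure.
Proof.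
apply: lty_fin_num_fun; rewrite [ltLHS](_ : _ = (mu \x nu) setT)//.
rewrite -setXTT product_measure1E// lte_mul_pinfty//.
- exact: fin_num_measure.
- by rewrite ltey_eq fin_num_measure.
Qed.

HB.instance Definition _ := Measure_isFinite.Build _ _ _ cons_measure
  cons_measure_fin.
End cons.

(* The n-fold product mu (x) ... (x) mu, transported from T * n.-tuple T to
   n.+1.-tuple T along (x, t) |-> x :: t. *)
Fixpoint tuple_measure (mu : {finite_measure set T -> \bar R}) (n : nat) :
    {finite_measure set (n.-tuple T) -> \bar R} :=
  match n with
  | 0%N => \d_([tuple] : 0.-tuple T)
  | n'.+1 => cons_measure mu (tuple_measure mu n')
  end.

End tuple_measure.

Section nc_derivative.
Context (R : realType).

Definition sym_itv : set R := [set x | -2 <= x <= 2].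

Definition diff_quotient (f : R -> R) (x y : R) : R := (f y - f x) / (y - x).

(* Derivative of f as a function on [-2, 2]: one-sided at the endpoints, and
   depending only on the values of f on [-2, 2]. *)
Definition deriv_itv (f : R -> R) (x : R) : R :=
  lim (diff_quotient f x y @[y --> within sym_itv x^']).

Definition smooth_itv (f : R -> R) : Prop :=
  forall (n : nat) (x : R), sym_itv x ->
    cvg (diff_quotient (iter n deriv_itv f) x y @[y --> within sym_itv x^']).

(* For f smooth on [-2, 2], the value on the diagonal is the continuous
   extension of the difference quotient. *)
Definition nc_deriv (f : R -> R) (x y : R) : R :=
  if x == y then deriv_itv f x else (f x - f y) / (x - y).

(* (x, y, r) |-> (F (x, r) - F (y, r)) / (x - y), where F is the k'-th
   derivative: the derivation acts on the first variable. *)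
Fixpoint nc_derivn (f : R -> R) (k : nat) : k.+1.-tuple R -> R :=
  match k return k.+1.-tuple R -> R with
  | 0%N => fun t => f (thead t)
  | k'.+1 => fun t =>
      let rest : k'.-tuple R := [tuple of behead (behead t)] in
      nc_deriv (fun u => nc_derivn f [tuple of u :: rest])
        (thead t) (thead [tuple of behead t])
  end.

Definition cube (l : nat) : set (l.-tuple R) :=
  [set t | forall i, sym_itv (tnth t i)].

(* fine only drops the EFin: for smooth f the function nc_derivn f is bounded
   on the cube, so its norm is finite. *)
Definition norm_alpha (l : nat) (F : l.-tuple R -> R) : R :=
  fine ('N[tuple_measure semicircular l]_2%:E[EFin \o (F \_ @cube l)])%E.

Definition inner_beta (f g : R -> R) : R :=
  \int[arcsine]_(x in sym_itv) (f x * g x).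

Definition counting_op (phi : R -> R) (x : R) : R :=
  \int[arcsine]_(y in sym_itv) (y * deriv_itv phi y)
  + x * \int[arcsine]_(y in sym_itv) deriv_itv phi y
  - (4 - x ^+ 2) * \int[arcsine]_(y in sym_itv) nc_deriv (deriv_itv phi) x y.

(* The l-th term of the expansion, meaningful for l >= 1; nc_derivn at order
   l.-1 is then a function of l variables. *)
Definition expansion_term (phi : R -> R) (l : nat) : R :=
  (-1) ^+ l.-1 / l%:R * norm_alpha (@nc_derivn (deriv_itv phi) l.-1) ^+ 2.

End nc_derivative.
Arguments nc_derivn {R} f k t.

(* Main.v *)
(* For u_n(2 cos t) = sin((n+1)t)/sin t and C_n(2 cos t) = 2 cos(nt), a
   polynomial phi = sum_n c_n C_n satisfies N C_n = n C_n, so that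
   <N phi, phi>/2 = sum_n n c_n^2 (the arcsine law makes the C_n orthogonal).
   On the other hand phi' = sum_n n c_n u_{n-1}, the u_n are orthonormal for the
   semicircular law, and the (l-1)-st divided difference of u_m is the sum of
   u_{i_1} (x) ... (x) u_{i_l} over all compositions i_1 + ... + i_l = m - l + 1.
   Counting compositions gives ||d^(l-1) phi'||^2 = sum_n l 'C(n, l) n c_n^2, and
   the alternating sum of binomials 1 - sum_{1 <= l <= L} (-1)^(l-1) 'C(n, l) =
   (-1)^L 'C(n-1, L) yields the sign of the remainder.  A smooth phi is
   approximated, together with finitely many derivatives, by polynomials
   (Bernstein approximation of the top derivative, then integration), and both
   sides pass to the limit by dominated convergence; the series statement follows
   by squeezing between even and odd partial sums. *)
Require Import Defs.
From HB Require Import structures.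
From mathcomp Require Import all_boot all_order all_algebra.
From mathcomp Require Import all_classical all_reals all_analysis.
From mathcomp Require Import measurable_realfun.
From mathcomp Require Import ring lra zify.

Set Implicit Arguments.
Unset Strict Implicit.
Unset Printing Implicit Defensive.

Import Order.TTheory GRing.Theory Num.Theory.
Import numFieldNormedType.Exports.

Local Open Scope classical_set_scope.
Local Open Scope ring_scope.

(** Two obstacles shape the argument. The arcsine density is unbounded at the endpoints, so the
    means of the [C_n] come from an explicit antiderivative on the open interval, applied to the
    nonnegative functions [C_n + M]; semicircular integrals then reduce to arcsine ones through the
    density ratio [(4 - x^2) / 2]. For smooth [phi], the operator [nc_deriv] contains the limit
    [deriv_itv] on the diagonal, and pointwise convergence alone does not pass to derivatives. What
    rescues it is that, on [[-2, 2]], the [j]-th derivative of a divided difference of a polynomial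
    is bounded by any bound on the derivative of order [j + 1], with no loss in the constant. A
    single bound [M] on finitely many derivatives of the approximating polynomials therefore
    controls all the iterated divided differences, makes Taylor remainders uniform along the
    sequence, and dominates the integrands. Measurability and boundedness of the limit functions are
    inherited from the polynomials. Each truncation order [L] has its own approximating sequence,
    controlled up to order [L + 3]. *)

Lemma nat_ind2 (P : nat -> Prop) :
  P 0%N -> P 1%N -> (forall n, P n -> P n.+1 -> P n.+2) -> forall n, P n.
Proof.
move=> P0 P1 PS n; suff: P n /\ P n.+1 by case.
by elim: n => // n [Pn PSn]; split=> //; exact: PS.
Qed.

(** * Chebyshev polynomials rescaled to [[-2, 2]] *)

Section chebyshev.
Context (R : comNzRingType).
Implicit Types (p : {poly R}) (x y : R) (m n : nat).

(** Two consecutive values are carried along, so the three-term recursion is structural; the two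
    families differ only in their seeds. The coefficients lie in any commutative ring because the
    identities are later also used over [{poly R}]. *)
Fixpoint chebyshev_rec (a b : {poly R}) n : {poly R} :=
  if n is n'.+1 then chebyshev_rec b ('X * b - a) n' else a.

Lemma chebyshev_recSS a b n :
  chebyshev_rec a b n.+2 = 'X * chebyshev_rec a b n.+1 - chebyshev_rec a b n.
Proof. by elim: n a b => // n IH a b; exact: IH. Qed.

Definition chebU n : {poly R} := chebyshev_rec 1 'X n.
Definition chebC n : {poly R} := chebyshev_rec 2 'X n.

Lemma chebU0 : chebU 0 = 1. Proof. by []. Qed.
Lemma chebU1 : chebU 1 = 'X. Proof. by []. Qed.
Lemma chebUSS n : chebU n.+2 = 'X * chebU n.+1 - chebU n.
Proof. exact: chebyshev_recSS. Qed.
Lemma chebC0 : chebC 0 = 2. Proof. by []. Qed.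
Lemma chebC1 : chebC 1 = 'X. Proof. by []. Qed.
Lemma chebCSS n : chebC n.+2 = 'X * chebC n.+1 - chebC n.
Proof. exact: chebyshev_recSS. Qed.

(** With [x = 2 cos t] this is the addition formula for [sin((n + 2) t)]. It eliminates [chebC] in
    favour of [chebU] in the identities below. *)
Lemma chebC_U n : chebC n.+1 = 2 * chebU n.+1 - 'X * chebU n.
Proof.
elim/nat_ind2: n => [||n IH1 IH2].
- by rewrite chebC1 chebU1 chebU0; ring.
- by rewrite chebCSS chebC1 chebC0 chebUSS chebU1 chebU0; ring.
- by rewrite chebCSS IH1 IH2 (chebUSS n.+1) (chebUSS n); ring.
Qed.

Lemma chebCB n : chebC n.+2 = chebU n.+2 - chebU n.
Proof. by rewrite chebC_U chebUSS; ring. Qed.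

Lemma chebC_deriv n : (chebC n.+1)^`() = n.+1%:R * chebU n.
Proof.
elim/nat_ind2: n => [||n IH1 IH2].
- by rewrite chebC1 derivX chebU0 mulr1.
- by rewrite chebCSS chebC1 chebC0 derivB derivM derivX -[2]polyC_natr derivC chebU1; ring.
rewrite chebCSS derivB derivM derivX IH1 IH2 (chebC_U n.+1) (chebUSS n).
by rewrite -![_.+3%:R]natr1 -![_.+2%:R]natr1 -![_.+1%:R]natr1; ring.
Qed.

(** Differentiating [sin t * u_n(2 cos t) = sin((n + 1) t)] gives this relation. It says that
    [u_n * sqrt(4 - x^2)] has derivative [- (n + 1) C_{n+1} / sqrt(4 - x^2)], which provides the
    antiderivative [G] below. *)
Lemma chebU_ode n :
  (4 - 'X ^+ 2) * (chebU n)^`() = 'X * chebU n - n.+1%:R * chebC n.+1.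
Proof.
elim/nat_ind2: n => [||n IH1 IH2].
- by rewrite chebU0 chebC1 (_ : deriv 1 = 0); [ring|exact: derivC].
- by rewrite chebU1 derivX chebCSS chebC1 chebC0; ring.
rewrite chebUSS derivB derivM derivX.
rewrite (_ : _ * _ = (4 - 'X ^+ 2) * chebU n.+1 +
  'X * ((4 - 'X ^+ 2) * (chebU n.+1)^`()) - (4 - 'X ^+ 2) * (chebU n)^`());
  last by ring.
rewrite IH1 IH2 (chebC_U n.+2) (chebC_U n.+1) (chebC_U n).
rewrite (chebUSS n.+1) (chebUSS n).
by rewrite -![_.+3%:R]natr1 -![_.+2%:R]natr1 -![_.+1%:R]natr1; ring.
Qed.

(** From [2 sin t sin((n + 1) t) = cos(n t) - cos((n + 2) t)]. It turns semicircular means of the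
    [u_n] into arcsine means of the [C_n]. *)
Lemma chebU_mulC n : (4 - 'X ^+ 2) * chebU n = chebC n - chebC n.+2.
Proof.
case: n => [|n]; first by rewrite chebCSS chebC1 chebC0 chebU0; ring.
by rewrite !chebC_U (chebUSS n.+1) (chebUSS n); ring.
Qed.

Lemma chebUM m n :
  chebU m.+1 * chebU n.+1 = chebU m * chebU n + chebU (m + n).+2.
Proof.
elim/nat_ind2: m => [||m IH1 IH2].
- by rewrite chebU0 chebU1 add0n chebUSS; ring.
- by rewrite (chebUSS 0) chebU0 chebU1 add1n (chebUSS n.+1) (chebUSS n); ring.
- rewrite (chebUSS m.+1) !addSn (chebUSS (m + n).+2) -(addSn m n).
  rewrite mulrBl -mulrA IH2 IH1 (chebUSS m) addSn.
  ring.
Qed.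

(** The difference [C_m C_n - C_{m+n}] is [C_{|m-n|}], hence invariant under raising both indices by
    one. This form avoids the absolute value and suits induction. *)
Lemma chebCM m n : chebC m.+1 * chebC n.+1 + chebC (m + n) =
  chebC m * chebC n + chebC (m + n).+2.
Proof.
elim/nat_ind2: m => [||m IH1 IH2].
- by rewrite chebC0 chebC1 add0n chebCSS; ring.
- rewrite (chebCSS 0) chebC0 chebC1 add1n (chebCSS n.+1) (chebCSS n); ring.
- rewrite (chebCSS m.+1) !addSn (chebCSS (m + n).+2).
  rewrite mulrBl -mulrA.
  rewrite addSn in IH2.
  rewrite (_ : _ - _ + _ = 'X * (chebC m.+2 * chebC n.+1 + chebC (m + n).+1)
    - (chebC m.+1 * chebC n.+1 + chebC (m + n)) + chebC (m + n).+2
    - ('X * chebC (m + n).+1 - chebC (m + n))); last by ring.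
  by rewrite IH1 IH2 (chebCSS m) (chebCSS (m + n)); ring.
Qed.

(** Both sides obey the same recursion in [n]. Taken over [{poly R}] with [x] the indeterminate,
    this becomes an identity between polynomials in [divided_diff_chebU]. *)
Lemma chebU_divdiff n x y :
  (chebU n.+1).[x] - (chebU n.+1).[y] =
  (x - y) * \sum_(i < n.+1) (chebU i).[x] * (chebU (n - i)).[y].
Proof.
elim/nat_ind2: n => [||n IH1 IH2].
- by rewrite big_ord1 subnn chebU0 chebU1 !hornerE /= !mulr1.
- rewrite !big_ord_recl big_ord0 /= /bump /= subn0 subnn chebUSS chebU0 chebU1 !hornerE.
  by rewrite /= addr0; ring.
pose S n := \sum_(i < n.+1) (chebU i).[x] * (chebU (n - i)).[y].
(* The recursion of the first factor gives a recursion for the sums; the term [i = 0], which it does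
   not reach, leaves the inhomogeneous part. *)
have -> : \sum_(i < n.+3) (chebU i).[x] * (chebU (n.+2 - i)).[y] =
    (chebU n.+2).[y] + x * S n.+1 - S n.
  rewrite 2!big_ord_recl /= /bump /= ?add1n ?add0n subn0 chebU0 hornerC mul1r.
  rewrite /S [in x * _]big_ord_recl /= ?subn0 ?chebU0 ?hornerC ?mul1r chebU1 hornerX ?subn1 /=.
  rewrite -!addrA; congr (_ + _).
  rewrite mulrDr -addrA; congr (_ + _).
  rewrite mulr_sumr -sumrB; apply: eq_bigr => i _.
  rewrite /bump /= ?add1n chebUSS !hornerE ?subSS.
  by rewrite /= mulrBl.
rewrite mulrBr mulrDr -IH1 (mulrCA _ x) -IH2 (chebUSS n.+1) !hornerE.
ring.
Qed.

Lemma size_chebC n : (size (chebC n) <= n.+1)%N.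
Proof.
elim/nat_ind2: n => [||n IH1 IH2].
- by rewrite chebC0 -polyC_natr size_polyC leq_b1.
- by rewrite chebC1 size_polyX.
rewrite chebCSS (leq_trans (size_polyD _ _))// geq_max size_polyN.
rewrite (leq_trans IH1)// ?(leq_trans (size_polyMleq _ _)) ?size_polyX//=.
by rewrite ltnW// ltnS ltnW.
Qed.
End chebyshev.

Section chebyshev_expansion.
Context (F : numFieldType).

Lemma chebC_lead n : (0 < n)%N -> (chebC F n)`_n = 1.
Proof.
elim/nat_ind2: n => // [_|n _ IH _].
  by rewrite chebC1 coefX.
rewrite chebCSS coefB coefXM/= IH// [X in _ - X]nth_default ?subr0//.
exact: leq_trans (size_chebC _ _) _.
Qed.

Lemma chebC_expansion (p : {poly F}) N : (size p <= N)%N ->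
  exists c : nat -> F, p = \sum_(i < N) c i *: chebC F i.
Proof.
elim: N p => [p|N IH p sp].
  by rewrite leqn0 size_poly_eq0 => /eqP ->; exists (fun=> 0); rewrite big_ord0.
pose a := p`_N / (chebC F N)`_N.
have [|c cE] := IH (p - a *: chebC F N).
  apply/leq_sizeP => j; rewrite leq_eqVlt => /predU1P[<-|Nj].
    rewrite coefB coefZ /a divfK ?subrr//.
    (* [chebC F 0 = 2] is the only member that is not monic; its leading coefficient is still
       nonzero in a numeric field. *)
    case: N {IH sp a} => [|N]; last by rewrite chebC_lead ?oner_eq0.
    by rewrite chebC0 -polyC_natr coefC/= pnatr_eq0.
  rewrite coefB coefZ !nth_default ?mulr0 ?subr0//.
    exact: leq_trans (size_chebC _ _) _.
  exact: leq_trans sp _.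
exists (fun i => if (i < N)%N then c i else a).
rewrite big_ord_recr /= ltnn -[LHS](subrK (a *: chebC F N)) cE.
by congr (_ + _); apply: eq_bigr => i _; rewrite ltn_ord.
Qed.
End chebyshev_expansion.

(** * Integration against the semicircular and arcsine laws *)

Section density_integral.
Import HBNNSimple.
Local Open Scope ereal_scope.
Context (R : realType) (f : R -> R).
Hypothesis mf : measurable_fun setT f.
Hypothesis f0 : forall x, (0 <= f x)%R.
Variable nu : {measure set (measurableTypeR R) -> \bar R}.
Hypothesis nuE : forall A, measurable A -> nu A = density_measure f A.
Local Notation mu := (@lebesgue_measure R).

(** For indicators this is the definition of [density_measure]; linearity gives simple functions,
    and monotone convergence on both sides gives the rest. *)
Lemma ge0_integral_density (g : measurableTypeR R -> \bar R) : measurable_fun setT g ->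
  (forall x, 0 <= g x) -> \int[nu]_x g x = \int[mu]_x (g x * (f x)%:E).
Proof.
move=> mg g0; pose g_ := nnsfun_approx (@measurableT _ (measurableTypeR R)) mg.
have mfE : measurable_fun setT (EFin \o f) by exact/measurable_EFinP.
transitivity (limn (fun n => \int[nu]_x (g_ n x)%:E)).
  rewrite -monotone_convergence//.
  - apply: eq_integral => y _; apply/esym/cvg_lim => //.
    exact: cvg_nnsfun_approx.
  - by move=> n; exact/measurable_EFinP/measurable_funP.
  - by move=> n y _; rewrite lee_fin.
  - by move=> y _ m n mn; rewrite lee_fin; exact/lefP/nd_nnsfun_approx.
rewrite [X in limn X](_ : _ = (fun n => \int[mu]_x ((g_ n x)%:E * (f x)%:E))).
  rewrite -monotone_convergence//; last 3 first.
    - by move=> n; apply: emeasurable_funM => //; exact/measurable_EFinP/measurable_funP.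
    - by move=> n x _; rewrite mule_ge0// lee_fin.
    - move=> x _ m n mn; rewrite lee_wpmul2r ?lee_fin//.
      exact/lefP/nd_nnsfun_approx.
  apply: eq_integral => x _; apply/cvg_lim => //.
  apply: cvgeZr => //; exact: cvg_nnsfun_approx.
apply/funext => n.
have mA k : measurable (g_ n @^-1` [set k]) by [].
transitivity (\sum_(k \in range (g_ n))
    \int[nu]_x (k * \1_(g_ n @^-1` [set k]) x)%:E).
  under eq_integral do rewrite fimfunE -fsumEFin//.
  rewrite ge0_integral_fsum//.
  - by move=> y; exact/measurable_EFinP/measurable_funM.
  - by move=> y x _; rewrite nnfun_muleindic_ge0.
transitivity (\sum_(k \in range (g_ n))
    \int[mu]_x ((k * \1_(g_ n @^-1` [set k]) x)%:E * (f x)%:E)).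
  apply: eq_fsbigr => r /[!inE] -[x _ gx].
  have r0 : (0 <= r)%R by rewrite -gx.
  rewrite integralZl_indic_nnsfun// integral_indic// setIT nuE//.
  under [RHS]eq_integral do rewrite EFinM -muleA.
  rewrite ge0_integralZl//; last 2 first.
  - by apply: emeasurable_funM => //; exact/measurable_EFinP.
  - by move=> y _; rewrite mule_ge0// lee_fin.
  congr (_ * _); rewrite /density_measure [LHS]integral_mkcond.
  by apply: eq_integral => y _; rewrite epatch_indic/= muleC.
rewrite -ge0_integral_fsum//.
- apply: eq_integral => x _; rewrite -ge0_mule_fsuml ?fsumEFin// -?fimfunE//.
  by move=> k; rewrite nnfun_muleindic_ge0.
- move=> r; apply: emeasurable_funM => //.
  exact/measurable_EFinP/measurable_funM.
- move=> r x _; apply: mule_ge0; last by rewrite lee_fin.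
  by rewrite EFinM nnfun_muleindic_ge0.
Qed.

Lemma integral_density (g : measurableTypeR R -> R) : measurable_fun setT g ->
  \int[nu]_x (g x)%:E = \int[mu]_x (g x * f x)%:E.
Proof.
move=> mg; rewrite [LHS]integralE [RHS]integralE.
congr (_ - _); rewrite ge0_integral_density//.
- apply: eq_integral => x _; rewrite !funeposE -!EFin_max -EFinM.
  by rewrite maxr_pMl// mul0r.
- by apply: measurable_funepos; exact/measurable_EFinP.
- apply: eq_integral => x _; rewrite !funenegE -!EFinN -!EFin_max -EFinM.
  by rewrite maxr_pMl// mul0r mulNr.
- by apply: measurable_funeneg; exact/measurable_EFinP.
Qed.
End density_integral.

(** * Fundamental theorem of calculus for nonnegative integrands that may blow up at the
    endpoints *)

Section ge0_FTC2_oo.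
Context (R : realType).
Local Notation mu := (@lebesgue_measure R).

(** The compact intervals [A n] exhaust the open one. On each of them the usual theorem applies, and
    nonnegativity lets the integrals pass to the limit by monotonicity. *)
Lemma ge0_continuous_FTC2_oo (F g : R -> R) (a b : R) : a < b ->
  (forall x, x \in `]a, b[ -> is_derive x 1 F (g x)) ->
  {in `]a, b[, continuous g} ->
  {in `]a, b[, forall x, 0 <= g x} ->
  F x @[x --> a^'+] --> F a -> F x @[x --> b^'-] --> F b ->
  (\int[mu]_(x in `]a, b[) (g x)%:E = (F b - F a)%:E)%E.
Proof.
move=> ab dF cg g0 Fa Fb.
(* Starting the denominators at 3 keeps [a + e n < b - e n] from [n = 0] on. *)
pose e n := (b - a) / n.+3%:R : R.
have e0 n : 0 < e n by rewrite divr_gt0 ?subr_gt0.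
have e3 n : e n <= (b - a) / 3.
  by rewrite ler_pM2l ?subr_gt0// lef_pV2 ?posrE// ler_nat.
have ab3 : (b - a) / 3 < b - a by rewrite ltr_pdivrMr// ltr_pMr ?subr_gt0// ltr1n.
have e_cvg : e n @[n --> \oo] --> 0.
  rewrite -(mulr0 (b - a)); apply: cvgM; first exact: cvg_cst.
  have := @cvg_harmonic R; rewrite -(cvg_shiftn 2) /harmonic/=.
  by apply: cvg_trans; apply: near_eq_cvg; near=> n; rewrite addn2.
pose A n := `[a + e n, b - e n]%classic.
have Asub n : A n `<=` `]a, b[.
  move=> x; rewrite /A /= !in_itv/= => /andP[ax xb].
  by rewrite (lt_le_trans _ ax) ?ltrDl// (le_lt_trans xb)// ltrBlDr ltrDl.
have ltA n : a + e n < b - e n.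
  by have := e3 n; have := ab; lra.
have ndA : nondecreasing_seq A.
  apply/nondecreasing_seqP => n; rewrite subsetEset => x.
  have : e n.+1 <= e n by rewrite ler_pM2l ?subr_gt0// lef_pV2 ?posrE// ler_nat.
  by rewrite /A /= !in_itv/=; lra.
have bigA : \bigcup_n A n = `]a, b[%classic.
  rewrite eqEsubset; split; first by move=> x [n _]; exact: Asub.
  move=> x; rewrite /= in_itv/= => /andP[ax xb].
  have : \forall n \near \oo, e n < Num.min (x - a) (b - x).
    apply: (cvgr_lt 0) => //; last by rewrite lt_min !subr_gt0 ax.
  case=> n _ /(_ n (leqnn n)) /=; rewrite lt_min => /andP[ea eb].
  by exists n => //; rewrite /A /= in_itv/=; apply/andP; split; lra.
have gA n : (\int[mu]_(x in A n) (g x)%:E = (F (b - e n) - F (a + e n))%:E)%E.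
  have sub x : x \in `](a + e n), (b - e n)[ -> x \in `]a, b[.
    rewrite in_itv/= => /andP[? ?].
    by apply: (Asub n); rewrite /A /= in_itv/= !ltW.
  have inA x : A n x -> x \in `]a, b[ by move=> /Asub.
  rewrite EFinB; apply: continuous_FTC2 => //.
  - apply/continuous_in_subspaceT => x /[1!inE] xA; exact/cg/inA.
  - have cF x : A n x -> {for x, continuous F}.
      move=> /inA xab; apply/differentiable_continuous; rewrite -derivable1_diffP.
      by have [] := dF _ xab.
    split.
    + by move=> x /sub xab; have [] := dF _ xab.
    + apply: cvg_at_right_filter; apply: cF.
      by rewrite /A /= in_itv/= lexx ltW.
    + apply: cvg_at_left_filter; apply: cF.
      by rewrite /A /= in_itv/= lexx ltW.
  - by move=> x /sub xab; rewrite derive1E; have [_ ->] := dF _ xab.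
have : (\int[mu]_(x in A n) (g x)%:E @[n --> \oo] -->
    \int[mu]_(x in \bigcup_n A n) (g x)%:E)%E.
  apply: ge0_nondecreasing_set_cvg_integral => //.
  - by move=> n; exact: measurable_itv.
  - move=> n; apply/measurable_EFinP; apply: subspace_continuous_measurable_fun.
      exact: measurable_itv.
    by apply/continuous_in_subspaceT => x /[1!inE] /Asub xA; exact: cg.
  - by move=> n x /Asub xA; rewrite lee_fin g0.
rewrite bigA => /cvg_lim <- //; apply/cvg_lim => //.
under eq_fun do rewrite gA.
apply: cvg_EFin; first by near=> n.
apply: cvgB.
- move/cvg_at_leftP : Fb; apply; split.
  + by move=> n; rewrite ltrBlDr ltrDl.
  + by rewrite -[X in _ --> X]subr0; apply: cvgB => //; exact: cvg_cst.
- move/cvg_at_rightP : Fa; apply; split.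
  + by move=> n; rewrite ltrDl.
  + by rewrite -[X in _ --> X]addr0; apply: cvgD => //; exact: cvg_cst.
Unshelve. all: by end_near. Qed.
End ge0_FTC2_oo.

Lemma cvgn_norm_le (R : realFieldType) (u : nat -> R) (l M : R) :
  u n @[n --> \oo] --> l -> (forall n, `|u n| <= M) -> `|l| <= M.
Proof.
move=> ul uM; apply: (ler_cvg_to (cvg_norm ul) (cvg_cst M)).
by apply: nearW => n; exact: uM.
Qed.

Section bounded_integrals.
Context d (T : measurableType d) (R : realType).
Variables (mu : {measure set T -> \bar R}) (D : set T).
Hypotheses (mD : measurable D) (muD : (mu D < +oo)%E).

Lemma bounded_integrable (f : T -> R) (M : R) : measurable_fun D f ->
  (forall x, D x -> `|f x| <= M) -> mu.-integrable D (EFin \o f).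
Proof.
move=> mf fM; apply: measurable_bounded_integrable => //.
exists M; split; first exact: num_real.
by move=> N MN x Dx /=; rewrite (le_trans (fM _ Dx))// ltW.
Qed.

Lemma bounded_cvg_Rintegral (f_ : nat -> T -> R) (f : T -> R) (M : R) :
  (forall n, measurable_fun D (f_ n)) ->
  (forall n x, D x -> `|f_ n x| <= M) ->
  (forall x, D x -> f_ n x @[n --> \oo] --> f x) ->
  \int[mu]_(x in D) f_ n x @[n --> \oo] --> \int[mu]_(x in D) f x.
Proof.
move=> mf_ fM f_f.
have mf : measurable_fun D f by apply: measurable_fun_cvg f_f.
have h1 : {ae mu, forall x, D x -> (EFin \o f_ n) x @[n --> \oo] --> (EFin \o f) x}.
  by apply: aeW => x Dx; apply: cvg_EFin; [near=> n|exact: f_f].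
have h2 : mu.-integrable D (EFin \o cst M).
  exact: (@bounded_integrable _ `|M|).
have h3 : {ae mu, forall x n, D x -> (`|(EFin \o f_ n) x| <= (EFin \o cst M) x)%E}.
  by apply: aeW => x n Dx; rewrite lee_fin fM.
have [_ _] := @dominated_convergence _ T R mu D mD (fun n => EFin \o f_ n) _ _
  (fun n => (measurable_EFinP _ _).2 (mf_ n)) ((measurable_EFinP _ _).2 mf) h1 h2 h3.
move=> cf; rewrite /Rintegral; apply: fine_cvg; rewrite fineK.
  exact: cf.
apply: integrable_fin_num => //.
apply: (@bounded_integrable _ M) => // x Dx.
by apply: (cvgn_norm_le (f_f _ Dx)) => n; exact: fM.
Unshelve. all: by end_near. Qed.
End bounded_integrals.

(** * Means of polynomials under the arcsine law *)

Section arcsine_integral.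
Context (R : realType).
Local Notation I := (@sym_itv R).
Local Notation mu := (@lebesgue_measure R).
Implicit Types p q : {poly R}.

Lemma sym_itvE : I = `[-2, 2]%classic.
Proof. by apply/seteqP; split => x; rewrite /= in_itv. Qed.

Lemma measurable_sym_itv : measurable I.
Proof. by rewrite sym_itvE; exact: measurable_itv. Qed.
Local Hint Resolve measurable_sym_itv : core.

Lemma measurable_horner p : measurable_fun [set: R] (horner p).
Proof. by apply: continuous_measurable_fun; exact: continuous_horner. Qed.

Lemma horner_bounded p : exists2 M, 0 <= M & forall x, I x -> `|p.[x]| <= M.
Proof.
elim/poly_ind: p => [|p c [M M0 pM]].
  by exists 0 => // x _; rewrite horner0 normr0.
exists (M * 2 + `|c|); first by rewrite addr_ge0// mulr_ge0.
move=> x Ix; rewrite !hornerE (le_trans (ler_normD _ _))// lerD2r normrM.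
by rewrite ler_pM// ?pM// ler_norml.
Qed.

Let s (x : R) : R := Num.sqrt (4 - x ^+ 2).

Let s_continuous : continuous s.
Proof.
move=> x; apply: continuous_comp; last exact: sqrt_continuous.
by apply: cvgB; [exact: cvg_cst|exact: exprn_continuous].
Qed.

Let s_gt0 x : x \in `]-2, 2[ -> 0 < s x.
Proof. by rewrite in_itv/= => /andP[? ?]; rewrite sqrtr_gt0; nra. Qed.

Let s2 x : x \in `]-2, 2[ -> s x ^+ 2 = 4 - x ^+ 2.
Proof. by rewrite in_itv/= => /andP[? ?]; rewrite sqr_sqrtr//; nra. Qed.

Lemma horner_4B (x : R) : (4 - 'X ^+ 2 : {poly R}).[x] = 4 - x ^+ 2.
Proof. by rewrite hornerD hornerN hornerXn -polyC_natr hornerC. Qed.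

Let is_derive_s (x : R) : x \in `]-2, 2[ -> is_derive x 1 s (- x / s x).
Proof.
move=> xI; have s0 := s_gt0 xI.
have d0 : 0 < 4 - x ^+ 2 by rewrite -sqrtr_gt0.
have dp : is_derive x 1 (horner (4 - 'X ^+ 2)) (4 - 'X ^+ 2 : {poly R})^`().[x].
  exact: is_derive_poly.
have ph : horner (4 - 'X ^+ 2) = (fun x : R => 4 - x ^+ 2).
  by apply/funext => y; rewrite horner_4B.
rewrite ph in dp.
have := @is_derive1_comp _ Num.sqrt _ x _ _ (is_derive1_sqrt d0) dp.
move/is_derive_eq; apply.
have -> : (4 - 'X ^+ 2 : {poly R})^`() = - ('X *+ 2).
  by rewrite -(polyC_natr R 4) derivB derivC derivXn sub0r.
rewrite hornerN hornerMn hornerX -/(s x) -mulr_natl.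
field; rewrite /= ?gt_eqF//.
Qed.

(* [2 atan(x / (2 + s x))] is [asin(x / 2)], in a form that is visibly continuous
   up to the endpoints. *)
Let is_derive_t (x : R) : x \in `]-2, 2[ ->
  is_derive x 1 (fun x => 2 * atan (x / (2 + s x))) (s x)^-1.
Proof.
move=> xI; have s0 := s_gt0 xI.
have ds := is_derive_s xI.
have h0 : (cst 2 + s) x != 0 by rewrite gt_eqF// addr_gt0.
have dv := is_deriveV h0 (is_deriveD (is_derive_cst (2 : R) x 1) ds).
have dd := is_deriveM (is_derive_id x 1) dv.
have := is_deriveZ 2 (is_derive1_comp (is_derive1_atan _) dd).
move/is_derive_eq; apply.
rewrite /GRing.scale/= add0r.
have e := s2 xI.
have h : (2 + s x) ^+ 2 + x ^+ 2 = 4 * (2 + s x).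
  by rewrite -[x ^+ 2](subKr 4) -e; ring.
have -> : 1 + (x / (2 + s x)) ^+ 2 = 4 / (2 + s x).
  apply: (@mulIf _ ((2 + s x) ^+ 2)); first by rewrite expf_neq0// gt_eqF// addr_gt0.
  by rewrite mulrDl mul1r -exprMn divfK ?gt_eqF ?addr_gt0// h; field; rewrite gt_eqF// addr_gt0.
have -> : x * (- (2 + s x) ^- 2 * (- x / s x)) + (2 + s x)^-1 * 1 =
    2 / (s x * (2 + s x)).
  have x2 : x * x = 4 - s x ^+ 2 by rewrite e; ring.
  transitivity ((x * x + s x * (2 + s x)) / (s x * (2 + s x) ^+ 2)).
    by field; rewrite !gt_eqF ?addr_gt0.
  by rewrite x2; field; rewrite !gt_eqF ?addr_gt0.
by field; rewrite !gt_eqF ?addr_gt0.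
Qed.

(** Antiderivative of [C_{n+1} + M] times the arcsine density: the arctangent term accounts for [M],
    and the term in [chebU R n] for [C_{n+1}], by [chebU_ode]. *)
Let G n M (x : R) : R := pi^-1 *
  (M * (2 * atan (x / (2 + s x))) - n.+1%:R^-1 * ((chebU R n).[x] * s x)).

Let is_derive_G n M (x : R) : x \in `]-2, 2[ ->
  is_derive x 1 (G n M) (((chebC R n.+1).[x] + M) / (pi * s x)).
Proof.
move=> xI; have s0 := s_gt0 xI.
have d1 := is_deriveZ M (is_derive_t xI).
have d2 := @is_deriveM _ _ _ _ x 1 _ _ (is_derive_poly (chebU R n) x) (is_derive_s xI).
have := is_deriveZ pi^-1 (is_deriveB d1 (is_deriveZ n.+1%:R^-1 d2)).
move/is_derive_eq; apply.
rewrite /GRing.scale/=.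
have /(congr1 (horner ^~ x)) := chebU_ode R n.
rewrite hornerM horner_4B hornerD hornerM hornerX hornerN hornerM.
rewrite -polyC_natr hornerC -s2// => ode.
have pi0 : pi != 0 :> R by rewrite gt_eqF// pi_gt0.
have N0 : n.+1%:R != 0 :> R by rewrite pnatr_eq0.
have {}s0 : s x != 0 by rewrite gt_eqF.
move: (n.+1%:R : R) N0 ode (pi : R) pi0 => N N0 ode P P0.
transitivity (P^-1 * (M / s x - N^-1 *
  ((s x ^+ 2 * (chebU R n)^`().[x] - x * (chebU R n).[x]) / s x))).
  by field; rewrite ?P0 ?N0 ?s0.
by rewrite ode; field; rewrite ?P0 ?N0 ?s0.
Qed.

Let G_continuous n M : continuous (G n M).
Proof.
move=> x; apply: cvgM; first exact: cvg_cst.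
apply: cvgB; apply: cvgM; try exact: cvg_cst.
  apply: cvgM; first exact: cvg_cst.
  apply: continuous_comp; last exact: continuous_atan.
  apply: cvgM; first exact: cvg_id.
  apply: cvgV; first by rewrite gt_eqF// ltr_pwDl// sqrtr_ge0.
  by apply: cvgD; [exact: cvg_cst|exact: s_continuous].
by apply: cvgM; [exact: continuous_horner|exact: s_continuous].
Qed.

Let s_end x : x ^+ 2 = 4 -> s x = 0.
Proof. by move=> x4; rewrite /s x4 subrr sqrtr0. Qed.

(* The constant [M] makes the integrand nonnegative, so that monotone convergence
   handles the singularities at the endpoints. *)
Lemma lebesgue_integral_chebC n M :
  {in `]-2, 2[, forall x, 0 <= (chebC R n.+1).[x] + M} ->
  (\int[mu]_(x in I) (((chebC R n.+1).[x] + M) * arcsine_pdf x)%:E = M%:E)%E.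
Proof.
move=> C0; rewrite sym_itvE integral_itv_bndoo; last first.
  apply/measurable_EFinP; apply: measurable_funTS; apply: measurable_funM.
    by apply: measurable_funD => //; exact: measurable_horner.
  exact: measurable_arcsine_pdf.
transitivity (\int[mu]_(x in `](-2)%R, 2%R[) (((chebC R n.+1).[x] + M) / (pi * s x))%:E)%E.
  apply: eq_integral => x /[1!inE]; rewrite /= in_itv/= => /andP[x1 x2].
  by rewrite /arcsine_pdf !ltW.
transitivity (G n M 2 - G n M (-2))%:E; last first.
  rewrite /G !s_end; [|by ring..].
  rewrite !mulr0 !subr0 !addr0 mulNr divff ?pnatr_eq0// atanN atan1.
  have := lt0r_neq0 (pi_gt0 R); move: (pi : R) => P P0.
  by congr EFin; field.
apply: ge0_continuous_FTC2_oo.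
- by lra.
- by move=> x xI; exact: is_derive_G.
- move=> x xI; have s0 := s_gt0 xI.
  apply: cvgM; first by apply: cvgD; [exact: continuous_horner|exact: cvg_cst].
  apply: cvgV; first by rewrite gt_eqF// mulr_gt0// pi_gt0.
  by apply: cvgM; [exact: cvg_cst|exact: s_continuous].
- move=> x xI; rewrite mulr_ge0 ?C0// invr_ge0 mulr_ge0 ?pi_ge0//.
  exact: sqrtr_ge0.
- by apply: cvg_at_right_filter; exact: G_continuous.
- by apply: cvg_at_left_filter; exact: G_continuous.
Qed.

Lemma arcsine_integral (g : measurableTypeR R -> R) : measurable_fun setT g ->
  (\int[arcsine]_(x in I) (g x)%:E = \int[mu]_(x in I) (g x * arcsine_pdf x)%:E)%E.
Proof.
move=> mg; rewrite integral_mkcond [RHS]integral_mkcond.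
transitivity (\int[arcsine]_x ((g \_ I) x)%:E)%E.
  by apply: eq_integral => x _; rewrite !patchE; case: ifPn.
rewrite (integral_density (@measurable_arcsine_pdf R) (@arcsine_pdf_ge0 R))//.
  by apply: eq_integral => x _; rewrite !patchE; case: ifPn; rewrite // mul0r.
by apply/(measurable_restrictT _ measurable_sym_itv); exact: measurable_funTS.
Qed.

(** The previous computation starts at [C_1 = X], so the total mass is recovered as the difference
    of the integrals of [x + 3] and [x + 2], which are nonnegative on the interval and integrate to
    3 and 2. *)
Lemma arcsine_sym_itv : arcsine I = 1%E.
Proof.
have XE M : 2 <= M -> (\int[mu]_(x in I) ((x + M) * arcsine_pdf x)%:E = M%:E)%E.
  move=> M2; rewrite -[RHS](@lebesgue_integral_chebC 0).
    by apply: eq_integral => x _; rewrite chebC1 hornerX.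
  by move=> x; rewrite in_itv/= chebC1 hornerX => /andP[? ?]; lra.
have : (\int[mu]_(x in I) ((x + 3) * arcsine_pdf x)%:E =
    \int[mu]_(x in I) ((x + 2) * arcsine_pdf x)%:E + \int[mu]_(x in I) (arcsine_pdf x)%:E)%E.
  rewrite -ge0_integralD//.
  - by apply: eq_integral => x _; rewrite -EFinD; congr EFin; ring.
  - by move=> x /andP[? _]; rewrite lee_fin mulr_ge0 ?arcsine_pdf_ge0//; lra.
  - apply/measurable_EFinP/measurable_funTS/measurable_funM.
      exact: measurable_funD.
    exact: measurable_arcsine_pdf.
  - by move=> x _; rewrite lee_fin arcsine_pdf_ge0.
  - apply/measurable_EFinP/measurable_funTS; exact: measurable_arcsine_pdf.
rewrite !XE ?ler_nat// -[arcsine I]/(\int[mu]_(x in I) (arcsine_pdf x)%:E)%E.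
by case: (\int[mu]_(x in I) _)%E => // r [] r3; congr EFin; lra.
Qed.

Lemma arcsine_sym_itv_lty : (arcsine I < +oo)%E.
Proof. by rewrite arcsine_sym_itv ltry. Qed.
Local Hint Resolve arcsine_sym_itv_lty : core.

Lemma integrable_horner p : arcsine.-integrable I (EFin \o horner p).
Proof.
have [M _ pM] := horner_bounded p.
apply: (@bounded_integrable _ (measurableTypeR R) R arcsine I
  measurable_sym_itv arcsine_sym_itv_lty (horner p) M _ pM).
by apply: measurable_funTS; exact: measurable_horner.
Qed.

Definition arcsine_mean p : R := \int[arcsine]_(x in I) p.[x].

Fact arcsine_mean_is_linear : linear arcsine_mean.
Proof.
move=> a p q; rewrite /arcsine_mean.
transitivity (\int[arcsine]_(x in I) (a * p.[x] + q.[x])).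
  by apply: eq_Rintegral => x _; rewrite hornerD hornerZ.
have iap : arcsine.-integrable I (EFin \o (fun x => a * p.[x])).
  have -> : (fun x => a * p.[x]) = horner (a *: p).
    by apply/funext => x; rewrite hornerZ.
  exact: integrable_horner.
rewrite RintegralD//; last exact: integrable_horner.
by rewrite RintegralZl//; exact: integrable_horner.
Qed.
HB.instance Definition _ := GRing.isLinear.Build R {poly R} R _ arcsine_mean
  arcsine_mean_is_linear.

Lemma arcsine_mean1 : arcsine_mean 1 = 1.
Proof.
rewrite /arcsine_mean -[RHS]mul1r -[X in _ * X]/(fine 1) -arcsine_sym_itv.
by rewrite -Rintegral_cst//; apply: eq_Rintegral => x _; rewrite hornerC.
Qed.

(** For positive index, adding a bound [M] of the polynomial makes the integrand nonnegative, and
    the integral of the shifted function is [M] itself. For index 0 the value 2 is that of [C_0]. *)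
Lemma arcsine_mean_chebC n : arcsine_mean (chebC R n) = 2 * (n == 0)%:R.
Proof.
case: n => [|n]; first by rewrite chebC0 -[2]mulr_natl mulr1 linearMn/= arcsine_mean1 mulr1.
rewrite mulr0; have [M _ CM] := horner_bounded (chebC R n.+1).
apply: (addIr M); rewrite add0r.
transitivity (arcsine_mean (chebC R n.+1 + M%:P)).
  by rewrite linearD -(mulr1 M%:P) mul_polyC linearZ/= arcsine_mean1 /GRing.scale/= mulr1.
rewrite /arcsine_mean /Rintegral (arcsine_integral (measurable_horner _)).
rewrite -[RHS]/(fine M%:E) -(@lebesgue_integral_chebC n).
  by congr fine; apply: eq_integral => x _; rewrite hornerD hornerC.
move=> x /subset_itv_oo_cc; rewrite in_itv/= => xI.
by have := CM _ xI; rewrite ler_norml -lerBlDr sub0r => /andP[].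
Qed.

Lemma semicircular_integral p :
  \int[semicircular]_x ((horner p) \_ I) x = 2^-1 * arcsine_mean ((4 - 'X ^+ 2) * p).
Proof.
have -> q : 2^-1 * arcsine_mean q = arcsine_mean (2^-1 *: q) by rewrite linearZ.
rewrite /arcsine_mean /Rintegral (arcsine_integral (measurable_horner _)).
rewrite (integral_density (@measurable_semicircular_pdf R) (@semicircular_pdf_ge0 R))//; last first.
  apply/(measurable_restrictT _ measurable_sym_itv)/measurable_funTS.
  exact: measurable_horner.
rewrite [in RHS]integral_mkcond; congr fine; apply: eq_integral => x _.
rewrite !patchE; case: ifPn => [|_]; last by rewrite mul0r.
rewrite inE /sym_itv/= => xI; congr EFin.
rewrite hornerZ hornerM horner_4B /semicircular_pdf /arcsine_pdf xI -/(s x).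
have x2 : 4 - x ^+ 2 = s x ^+ 2 by rewrite sqr_sqrtr//; move/andP: xI => [? ?]; nra.
rewrite x2; have := lt0r_neq0 (pi_gt0 R); move: (pi : R) => P P0.
(* At the endpoints both densities vanish, the arcsine one by the convention [0^-1 = 0]. *)
have [->|s0] := eqVneq (s x) 0; first by rewrite !(mulr0, mul0r, expr0n).
by field; rewrite P0 s0.
Qed.
End arcsine_integral.

(** * Orthogonality of tensor products of Chebyshev polynomials *)

Section bounded_measurable.
Context d (T : measurableType d) (R : realType).
Implicit Types f g : T -> R.

(** This class is stable under sums and products and integrable for every finite measure, so that
    expanded products can be integrated term by term. *)
Definition bounded_measurable f :=
  measurable_fun setT f /\ exists M, forall x, `|f x| <= M.

Lemma bounded_measurable_cst c : bounded_measurable (fun=> c).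
Proof. by split=> //; exists `|c|. Qed.

Lemma bounded_measurableD f g : bounded_measurable f -> bounded_measurable g ->
  bounded_measurable (fun x => f x + g x).
Proof.
move=> [mf [M fM]] [mg [N gN]]; split; first exact: measurable_funD.
by exists (M + N) => x; rewrite (le_trans (ler_normD _ _))// lerD.
Qed.

Lemma bounded_measurableM f g : bounded_measurable f -> bounded_measurable g ->
  bounded_measurable (fun x => f x * g x).
Proof.
move=> [mf [M fM]] [mg [N gN]]; split; first exact: measurable_funM.
by exists (M * N) => x; rewrite normrM ler_pM.
Qed.

Lemma bounded_measurable_sum (J : Type) (r : seq J) (F : J -> T -> R) :
  (forall j, bounded_measurable (F j)) ->
  bounded_measurable (fun x => \sum_(j <- r) F j x).
Proof.
move=> bF; elim: r => [|j r IH].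
  by under eq_fun do rewrite big_nil; exact: bounded_measurable_cst.
by under eq_fun do rewrite big_cons; exact: bounded_measurableD.
Qed.

Variable mu : {finite_measure set T -> \bar R}.

Lemma finite_measure_lty (A : set T) : measurable A -> (mu A < +oo)%E.
Proof. by move=> mA; rewrite ltey_eq fin_num_measure. Qed.

Lemma bounded_measurable_integrable f : bounded_measurable f ->
  mu.-integrable setT (EFin \o f).
Proof.
move=> [mf [M fM]]; apply: (bounded_integrable _ _ mf (M := M)) => //.
exact: finite_measure_lty.
Qed.

Lemma Rintegral_sum (J : Type) (r : seq J) (F : J -> T -> R) :
  (forall j, bounded_measurable (F j)) ->
  \int[mu]_x (\sum_(j <- r) F j x) = \sum_(j <- r) \int[mu]_x F j x.
Proof.
move=> bF; elim: r => [|j r IH].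
  rewrite big_nil; under eq_Rintegral do rewrite big_nil.
  by rewrite Rintegral_cst ?mul0r.
rewrite big_cons -IH -RintegralD//.
- by apply: eq_Rintegral => x _; rewrite big_cons.
- exact: bounded_measurable_integrable.
- by apply: bounded_measurable_integrable; exact: bounded_measurable_sum.
Qed.
End bounded_measurable.

Section tuple_integral.
Context d (T : measurableType d) (R : realType).

Lemma measurable_thead n :
  measurable_fun setT (fun t : n.+1.-tuple T => thead t).
Proof. exact: measurable_tnth. Qed.

Lemma bounded_measurable_cons n (f : T -> R) (g : n.-tuple T -> R) :
  bounded_measurable f -> bounded_measurable g ->
  bounded_measurable (fun t : n.+1.-tuple T => f (thead t) * g [tuple of behead t]).
Proof.
move=> [mf [M fM]] [mg [N gN]]; apply: bounded_measurableM.
  by split; [exact: (measurableT_comp (f := f) mf (@measurable_thead n))|exists M].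
by split; [exact: (measurableT_comp (f := g) mg (@measurable_behead _ T n))|exists N].
Qed.

(** [cons_measure] is the image of a product measure, so a change of variables followed by Fubini
    separates the head from the tail. *)
Lemma Rintegral_cons n (mu : {finite_measure set T -> \bar R})
    (nu : {finite_measure set (n.-tuple T) -> \bar R}) (f : T -> R)
    (g : n.-tuple T -> R) :
  bounded_measurable f -> bounded_measurable g ->
  \int[cons_measure mu nu]_t (f (thead t) * g ([tuple of behead t] : n.-tuple T)) =
  (\int[mu]_x f x) * \int[nu]_t g t.
Proof.
move=> bf bg; have bfg := bounded_measurable_cons bf bg.
have if_ := bounded_measurable_integrable mu bf.
have ig_ := bounded_measurable_integrable nu bg.
pose h (z : T * n.-tuple T) := f z.1 * g z.2.
have bh : bounded_measurable h.
  case: bf bg => [mf [M fM]] [mg [N gN]]; apply: bounded_measurableM.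
    by split; [exact: (measurableT_comp (f := f) mf measurable_fst)|exists M].
  by split; [exact: (measurableT_comp (f := g) mg measurable_snd)|exists N].
have hE (z : T * n.-tuple T) : f (thead [tuple of z.1 :: z.2]) *
    g [tuple of behead [tuple of z.1 :: z.2]] = h z.
  by congr (f _ * g _); apply/val_inj.
have ih : (mu \x nu)%E.-integrable setT (EFin \o h).
  have [mh [M hM]] := bh; apply: (bounded_integrable _ _ mh (M := M)) => //.
  by have := @finite_measure_lty _ _ _ (cons_measure mu nu) setT measurableT.
rewrite /Rintegral.
have -> : (\int[cons_measure mu nu]_t (f (thead t) * g [tuple of behead t])%:E =
    \int[(mu \x nu)%E]_z (h z)%:E)%E.
  have mt : measurable_fun [set: T * n.-tuple T] (fun p => [tuple of p.1 :: p.2]).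
    exact: measurable_cons.
  rewrite [LHS](@integral_pushforward _ _ _ _ R _ mt (mu \x nu)%E setT)//.
  - by apply: eq_integral => z _ /=; rewrite hE.
  - by apply/measurable_EFinP; case: bfg.
  - by rewrite preimage_setT; apply: eq_integrable ih => // z _ /=; rewrite hE.
rewrite -integral12_prod_meas1//.
rewrite -fineM ?integrable_fin_num//.
have gfin : (\int[nu]_y (g y)%:E)%E \is a fin_num by exact: integrable_fin_num.
rewrite -[in RHS](fineK gfin) -integralZr//; congr fine.
by apply: eq_integral => x _; rewrite fineK// /fubini_F/= -integralZl.
Qed.

Lemma Rintegral_nil (nu : 0.-tuple T -> R) : bounded_measurable nu ->
  \int[\d_([tuple] : 0.-tuple T)]_t nu t = nu [tuple].
Proof.
move=> [mnu _]; rewrite /Rintegral integral_dirac//; last exact/measurable_EFinP.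
by rewrite diracE in_setT mul1e.
Qed.
End tuple_integral.

(** * Sums of tensor products of the [u_i] and their inner products *)

Section chebyshev_tuple.
Context (R : realType).
Local Notation I := (@sym_itv R).

Definition chebU_itv n : R -> R := (horner (chebU R n)) \_ I.

(** This is the sum of [u_{i_1} (x) ... (x) u_{i_l}] over all [l]-tuples of nonnegative indices with
    sum [m]; for [l = 0] only the empty tuple, with [m = 0], contributes. *)
Fixpoint chebU_tuple (l m : nat) : l.-tuple R -> R :=
  match l return l.-tuple R -> R with
  | 0%N => fun=> (m == 0)%:R
  | l'.+1 => fun t =>
      \sum_(i < m.+1) chebU_itv i (thead t) *
        chebU_tuple (m - i) ([tuple of behead t] : l'.-tuple R)
  end.

(** Counts the terms of [chebU_tuple]; as these are orthonormal, it is also the squared norm. *)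
Fixpoint composition_number (l m : nat) : nat :=
  match l with
  | 0%N => (m == 0)
  | l'.+1 => \sum_(i < m.+1) composition_number l' (m - i)
  end.

Lemma composition_numberE l m : composition_number l.+1 m = 'C(m + l, l).
Proof.
elim: l m => [|l IH] m.
  rewrite bin0 /= big_ord_recr/= subnn big1// => i _.
  by rewrite subn_eq0 leqNgt ltn_ord.
have -> : composition_number l.+2 m = \sum_(i < m.+1) 'C(m - i + l, l).
  by apply: eq_bigr => i _; exact: IH.
elim: m => [|m IHm]; first by rewrite big_ord1 subnn !add0n !binn.
rewrite big_ord_recl subn0 [in RHS]addSn binS -IHm [RHS]addnC addSnnS.
by congr (_ + _)%N; apply: eq_bigr => i _.
Qed.

Lemma bounded_measurable_horner_itv (p : {poly R}) :
  bounded_measurable ((horner p) \_ I).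
Proof.
split.
  apply/(measurable_restrictT _ (@measurable_sym_itv R))/measurable_funTS.
  exact: measurable_horner.
have [M M0 pM] := horner_bounded p; exists M => x; rewrite patchE.
by case: ifPn => [/[1!inE]/pM//|_]; rewrite normr0.
Qed.

Lemma bounded_measurable_chebU_tuple l m : bounded_measurable (@chebU_tuple l m).
Proof.
elim: l m => [|l IH] m /=; first exact: bounded_measurable_cst.
apply: bounded_measurable_sum => i; apply: bounded_measurable_cons => //.
exact: bounded_measurable_horner_itv.
Qed.

(** By [chebUM], lowering both indices by one changes the product by some [u_n] with [n > 0], whose
    semicircular mean is zero. The induction ends when one factor is [u_0 = 1]. *)
Lemma chebU_itv_orthonormal i j :
  \int[semicircular]_x (chebU_itv i x * chebU_itv j x) = (i == j)%:R.
Proof.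
transitivity (\int[semicircular]_x ((horner (chebU R i * chebU R j)) \_ I) x).
  apply: eq_Rintegral => x _; rewrite /chebU_itv !patchE.
  by case: ifPn => _; rewrite ?hornerM ?mulr0.
rewrite semicircular_integral.
pose L n := 2^-1 * arcsine_mean ((4 - 'X ^+ 2) * chebU R n).
have LE n : L n = (n == 0)%:R.
  rewrite /L chebU_mulC linearB/= !arcsine_mean_chebC/= mulr0 subr0.
  by rewrite mulrA mulVf ?mul1r.
elim: i j => [|i IH] [|j].
- by rewrite [chebU R 0 * _]mul1r; exact: LE.
- by rewrite [chebU R 0 * _]mul1r; exact: LE.
- by rewrite [chebU R i.+1 * _]mulr1; exact: LE.
by rewrite chebUM mulrDr linearD/= mulrDr -[X in _ + X]/(L _) LE addr0 IH.
Qed.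

Local Notation mu := (tuple_measure (@semicircular R)).

Lemma chebU_tuple_orthogonal l m m' :
  \int[mu l]_t (@chebU_tuple l m t * @chebU_tuple l m' t) =
  (m == m')%:R * (composition_number l m)%:R.
Proof.
elim: l m m' => [|l IH] m m'.
  rewrite [LHS]Rintegral_nil; last by apply: bounded_measurableM; exact: bounded_measurable_cst.
  by rewrite /=; case: m m' => [|m] [|m']; rewrite /= !(mulr0, mulr1, mul0r).
pose F (ij : 'I_m.+1 * 'I_m'.+1) (t : l.+1.-tuple R) :=
  (chebU_itv ij.1 (thead t) * chebU_itv ij.2 (thead t)) *
  (chebU_tuple (m - ij.1) ([tuple of behead t] : l.-tuple R) *
   chebU_tuple (m' - ij.2) ([tuple of behead t] : l.-tuple R)).
have bU i j : bounded_measurable (fun x => chebU_itv i x * chebU_itv j x).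
  by apply: bounded_measurableM; exact: bounded_measurable_horner_itv.
have bD i j : bounded_measurable (fun t => @chebU_tuple l i t * @chebU_tuple l j t).
  by apply: bounded_measurableM; exact: bounded_measurable_chebU_tuple.
transitivity (\int[mu l.+1]_t \sum_ij F ij t).
  apply: eq_Rintegral => t _ /=; rewrite -(pair_bigA _ (fun i j => F (i, j) t)).
  rewrite big_distrl/=; apply: eq_bigr => i _; rewrite big_distrr/=.
  by apply: eq_bigr => j _; rewrite /F/=; ring.
rewrite Rintegral_sum; last first.
  by move=> ij; exact: (bounded_measurable_cons (bU ij.1 ij.2) (bD (m - ij.1) (m' - ij.2)))%N.
transitivity (\sum_(i < m.+1) \sum_(j < m'.+1) (i == j :> nat)%:R *
    ((m - i == m' - j)%N%:R * (composition_number l (m - i))%:R) : R).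
  rewrite pair_bigA; apply: eq_bigr => -[i j] _ /=.
  rewrite -IH -chebU_itv_orthonormal.
  exact: (@Rintegral_cons _ (measurableTypeR R) R l semicircular (mu l) _ _
    (bU i j) (bD (m - i) (m' - j)))%N.
rewrite /= natr_sum mulr_sumr; apply: eq_bigr => i _.
(* Orthonormality in the first variable leaves only [j = i], an index that occurs in the second sum
   exactly when [i <= m']. *)
have [im'|m'i] := leqP i m'.
  rewrite (bigD1 (Ordinal (im' : i < m'.+1)%N))//= eqxx mul1r.
  rewrite big1 ?addr0 => [|j /eqP ij].
    have im : (i <= m)%N by rewrite -ltnS.
    by rewrite -(eqn_add2r i) !subnK.
  rewrite (_ : (i == j :> nat) = false) ?mul0r//; apply/eqP => eij; apply: ij.
  exact/val_inj.
rewrite big1 => [|j _]; last first.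
  by rewrite gtn_eqF ?mul0r// (leq_trans _ m'i)// ltnS -ltnS.
by rewrite gtn_eqF ?mul0r// (leq_trans m'i)// -ltnS.
Qed.

Lemma chebU_tuple_sqnorm l N (b : nat -> R) :
  \int[mu l]_t ((\sum_(m < N) b m * chebU_tuple m t) ^+ 2) =
  \sum_(m < N) b m ^+ 2 * (composition_number l m)%:R.
Proof.
pose F (ij : 'I_N * 'I_N) (t : l.-tuple R) :=
  b ij.1 * b ij.2 * (chebU_tuple ij.1 t * chebU_tuple ij.2 t).
have bD i j : bounded_measurable (fun t => @chebU_tuple l i t * @chebU_tuple l j t).
  by apply: bounded_measurableM; exact: bounded_measurable_chebU_tuple.
transitivity (\int[mu l]_t \sum_ij F ij t).
  apply: eq_Rintegral => t _; rewrite -(pair_bigA _ (fun i j => F (i, j) t)).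
  rewrite expr2 big_distrl/=; apply: eq_bigr => i _; rewrite big_distrr/=.
  by apply: eq_bigr => j _; rewrite /F/=; ring.
rewrite Rintegral_sum; last first.
  move=> ij; exact: (bounded_measurableM
    (@bounded_measurable_cst _ _ _ (b ij.1 * b ij.2)) (bD ij.1 ij.2)).
transitivity (\sum_(i < N) \sum_(j < N) b i * b j *
    ((i == j :> nat)%:R * (composition_number l i)%:R) : R).
  rewrite pair_bigA; apply: eq_bigr => -[i j] _ /=.
  rewrite -chebU_tuple_orthogonal RintegralZl//.
  exact: (bounded_measurable_integrable (mu l) (bD i j)).
apply: eq_bigr => i _; rewrite (bigD1 i)//= eqxx mul1r big1 ?addr0 ?expr2//.
by move=> j ji; rewrite eq_sym (negbTE ji : (j == i :> nat) = false) mul0r mulr0.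
Qed.

Lemma norm_alpha_sqr l (F : l.-tuple R -> R) :
  bounded_measurable (F \_ @cube R l) ->
  norm_alpha F ^+ 2 = \int[mu l]_t ((F \_ @cube R l) t ^+ 2).
Proof.
move=> bF; rewrite /norm_alpha; set G := F \_ _.
have iG : (mu l).-integrable setT (EFin \o (fun t => G t ^+ 2)).
  apply: bounded_measurable_integrable.
  by under eq_fun do rewrite expr2; exact: bounded_measurableM.
have G0 : 0 <= \int[mu l]_t (G t ^+ 2) by apply: Rintegral_ge0 => t _; exact: sqr_ge0.
rewrite unlock /Lnorm.
have -> : (\int[mu l]_t (`|(EFin \o G) t| `^ 2) = (\int[mu l]_t (G t ^+ 2))%:E)%E.
  rewrite /Rintegral fineK; last exact: integrable_fin_num.
  by apply: eq_integral => t _; rewrite /= powR_mulrn// real_normK ?num_real.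
by rewrite poweR_EFin/= powR12_sqrt// sqr_sqrtr.
Qed.
End chebyshev_tuple.

(** * Derivatives and divided differences on [[-2, 2]] *)

Section derivative_on_itv.
Context (R : realType).
Local Notation I := (@sym_itv R).
Implicit Types (f g : R -> R) (p q : {poly R}) (x y : R).

(** Moving from [x] towards 0, or to the right from 0 itself, by at most 1 stays inside the
    interval, endpoints included. This makes the filter defining [deriv_itv] proper, so its limits
    are unique. *)
Lemma sym_itv_limit_point x (e : R) : I x -> 0 < e ->
  exists y, [/\ I y, y != x & `|y - x| <= e].
Proof.
move=> /andP[x1 x2] e0; pose d := Num.min e 1.
have d0 : 0 < d by rewrite lt_min e0 ltr01.
have de : d <= e by rewrite ge_min lexx.
have d1 : d <= 1 by rewrite ge_min lexx orbT.
have [xn|xp] := leP x 0; [exists (x + d)|exists (x - d)]; split.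
- by apply/andP; split; lra.
- by rewrite -subr_eq0 addrC addKr gt_eqF.
- by rewrite addrC addKr gtr0_norm.
- by apply/andP; split; lra.
- by rewrite -subr_eq0 addrC addKr oppr_eq0 gt_eqF.
- by rewrite addrC addKr normrN gtr0_norm.
Qed.

Lemma dnbhs_sym_itv_proper x : I x -> ProperFilter (within I x^').
Proof.
move=> Ix; apply: Build_ProperFilter_ex => A.
rewrite /within /= -nbhs_nearE /dnbhs /within /= => -[/= e e0 eA].
have [|y [Iy yx ye]] := @sym_itv_limit_point x (e / 2) Ix; first by rewrite divr_gt0.
exists y; apply: eA => //=; rewrite distrC (le_lt_trans ye)//.
by rewrite ltr_pdivrMr// ltr_pMr// ltr1n.
Qed.

Lemma deriv_itvE f x l : I x ->
  diff_quotient f x y @[y --> within I x^'] --> l -> deriv_itv f x = l.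
Proof.
by move=> Ix fl; apply/cvg_lim => //; exact: dnbhs_sym_itv_proper.
Qed.

Lemma deriv_itv_eq f g x : (forall y, I y -> f y = g y) -> I x ->
  deriv_itv f x = deriv_itv g x.
Proof.
move=> fg Ix; rewrite /deriv_itv; congr (lim _).
have h F G : (forall y, I y -> F y = G y :> R) ->
    diff_quotient F x y @[y --> within I x^'] `=>` diff_quotient G x y @[y --> within I x^'].
  move=> FG; apply: near_eq_cvg; apply: filterS (withinT I (dnbhs_filter x)) => y Iy.
  by rewrite /diff_quotient !FG.
by apply/seteqP; split; apply: h => // y /fg.
Qed.

(** A quadratic remainder is a pointwise inequality, so unlike the limit itself it survives passage
    to a limit of functions; [deriv_itv_cvg] relies on this. *)
Lemma cvg_diff_quotient f x l M : I x ->
  (forall y, I y -> `|f y - f x - l * (y - x)| <= M * (y - x) ^+ 2) ->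
  diff_quotient f x y @[y --> within I x^'] --> l.
Proof.
move=> Ix fM; apply/cvgrPdist_le => e e0.
have M0 : 0 < `|M| + 1 by rewrite ltr_pwDr.
have : \forall y \near x, `|x - y| < e / (`|M| + 1).
  by apply: nbhsx_ballx; rewrite divr_gt0.
move=> H; near=> y.
have Iy : I y by near: y; exact: withinT.
have yx : y - x != 0.
  by rewrite subr_eq0; near: y; apply: cvg_within; exact: withinT.
have -> : l - diff_quotient f x y = - ((f y - f x - l * (y - x)) / (y - x)).
  by rewrite /diff_quotient; field.
rewrite normrN normrM normfV ler_pdivrMr ?normr_gt0// (le_trans (fM _ Iy))//.
rewrite -real_normK ?num_real// expr2 mulrA ler_wpM2r//.
have : `|x - y| < e / (`|M| + 1) by near: y; apply: cvg_within; exact: nbhs_dnbhs.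
rewrite distrC ltr_pdivlMr// => /ltW; apply: le_trans.
rewrite mulrC ler_wpM2l// (le_trans (ler_norm _))// lerDl//.
Unshelve. all: by end_near. Qed.

(** With [y] fixed, the exact quotient is a polynomial in the other variable, and its value at [y]
    is [p'(y)]: the diagonal needs no separate case. *)
Definition divided_diff p y : {poly R} := (p - p.[y]%:P) %/ ('X - y%:P).

Lemma divided_diffE p y : divided_diff p y * ('X - y%:P) = p - p.[y]%:P.
Proof. by rewrite divpK// dvdp_XsubCl /root !hornerE subrr. Qed.

Lemma divided_diff_uniq p q y : q * ('X - y%:P) = p - p.[y]%:P ->
  divided_diff p y = q.
Proof. by rewrite -divided_diffE => /mulIf -> //; rewrite polyXsubC_eq0. Qed.

Lemma divided_diff_is_linear y : linear (divided_diff ^~ y).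
Proof.
move=> a p q; apply: divided_diff_uniq.
rewrite mulrDl -scalerAl !divided_diffE hornerD hornerZ rmorphD/= rmorphM/=.
by rewrite -!mul_polyC; ring.
Qed.

Lemma divided_diff_sum (J : Type) (r : seq J) (a : J -> R) (q : J -> {poly R}) y :
  divided_diff (\sum_(j <- r) a j *: q j) y = \sum_(j <- r) a j *: divided_diff (q j) y.
Proof.
elim: r => [|j r IH]; last by rewrite !big_cons divided_diff_is_linear IH.
by rewrite !big_nil; apply: divided_diff_uniq; rewrite mul0r horner0 subr0.
Qed.

Lemma horner_divided_diff p x y : (divided_diff p y).[x] * (x - y) = p.[x] - p.[y].
Proof.
by have /(congr1 (horner ^~ x)) := divided_diffE p y; rewrite !hornerE.
Qed.

Lemma derivn_divided_diff p y j :
  p^`(j.+1) = (divided_diff p y)^`(j.+1) * ('X - y%:P) + (divided_diff p y)^`(j) *+ j.+1.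
Proof.
elim: j => [|j IH].
  rewrite !derivn1 derivn0 mulr1n -[in LHS](subrK p.[y]%:P p) -divided_diffE.
  by rewrite derivD derivM derivXsubC derivC mulr1 addr0.
rewrite derivnS IH derivD derivM derivXsubC mulr1 derivMn -!derivnS.
by rewrite -addrA -mulrS.
Qed.

Lemma poly_MVT p x y : I x -> I y ->
  exists c, [/\ I c, `|c - y| <= `|x - y| & p.[x] - p.[y] = p^`().[c] * (x - y)].
Proof.
have H a b : a <= b -> exists2 c, c \in `[a, b] & p.[b] - p.[a] = p^`().[c] * (b - a).
  move=> ab; apply: (@MVT_segment R (horner p) (horner p^`())) => //.
  exact/continuous_subspaceT/continuous_horner.
move=> /andP[x1 x2] /andP[y1 y2]; have [xy|/ltW yx] := leP x y.
  have [c] := H _ _ xy; rewrite in_itv/= => /andP[c1 c2] e; exists c; split.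
  - by apply/andP; split; lra.
  - by rewrite !ler0_norm ?subr_le0//; lra.
  - by rewrite -(opprB y x) mulrN -e opprB.
have [c] := H _ _ yx; rewrite in_itv/= => /andP[c1 c2] e; exists c; split => //.
- by apply/andP; split; lra.
- by rewrite !ger0_norm ?subr_ge0//; lra.
Qed.

(** Since the constant [M] is unchanged, the estimate can be iterated over successive divided
    differences. *)
Lemma divided_diff_bound p y M j : I y ->
  (forall x, I x -> `|p^`(j.+1).[x]| <= M) ->
  forall x, I x -> `|(divided_diff p y)^`(j).[x]| <= M.
Proof.
move=> Iy pM x Ix; set q := divided_diff p y.
have [->|xy] := eqVneq x y.
  have := pM _ Iy; rewrite (derivn_divided_diff p y) !hornerE subrr mulr0 add0r hornerMn.
  apply: le_trans; rewrite normrMn mulrS lerDl mulrn_wge0//.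
(* With [p = p.[y] + ('X - y) q], Leibniz' rule gives
   [(('X - y)^(j+1) q^(j))' = ('X - y)^j p^(j+1)]. *)
pose G := q^`(j) * ('X - y%:P) ^+ j.+1.
have G' : G^`() = p^`(j.+1) * ('X - y%:P) ^+ j.
  rewrite (derivn_divided_diff p y) derivM -derivnS deriv_exp derivXsubC mul1r -/q /=.
  by rewrite -mulr_natr -[q^`(j) *+ _]mulr_natr exprS; ring.
have [c [Ic cx]] := poly_MVT G Ix Iy.
rewrite G' !hornerM !horner_exp !hornerXsubC subrr expr0n mulr0 subr0 => e.
have xy0 : 0 < `|x - y| ^+ j.+1 by rewrite exprn_gt0// normr_gt0 subr_eq0.
rewrite -(ler_pM2r xy0) -normrX -normrM e !normrM normrX exprSr mulrA.
rewrite ler_wpM2r// normrX ler_pM// ?pM// ?exprn_ge0// lerXn2r ?nnegrE//.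
Qed.

(** The remainder is exactly the second divided difference at [x], evaluated at [y], times
    [(y - x)^2]; two uses of [divided_diff_bound] bound it. *)
Lemma poly_taylor2 p M x y : I x -> I y ->
  (forall x, I x -> `|p^`(2).[x]| <= M) ->
  `|p.[y] - p.[x] - p^`().[x] * (y - x)| <= M * (y - x) ^+ 2.
Proof.
move=> Ix Iy pM; set q := divided_diff p x.
have -> : p^`().[x] = q.[x].
  have := derivn_divided_diff p x 0; rewrite derivn1 => ->.
  by rewrite !hornerE subrr mulr0 add0r derivn0 mulr1n.
rewrite -horner_divided_diff -/q -mulrBl -horner_divided_diff -mulrA -expr2 normrM.
rewrite [X in _ * X]ger0_norm ?sqr_ge0// ler_wpM2r ?sqr_ge0//.
have := @divided_diff_bound q x M 0; rewrite derivn0; apply => //.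
by move=> z Iz; have := @divided_diff_bound p x M 1; apply.
Qed.

Lemma deriv_itv_horner p x : I x -> deriv_itv (horner p) x = p^`().[x].
Proof.
move=> Ix; have [M _ pM] := horner_bounded p^`(2).
apply: (deriv_itvE Ix); apply: (cvg_diff_quotient Ix (M := M)) => y Iy.
exact: poly_taylor2.
Qed.

Lemma nc_deriv_eq f g x y : (forall y, I y -> f y = g y) -> I x -> I y ->
  nc_deriv f x y = nc_deriv g x y.
Proof.
move=> fg Ix Iy; rewrite /nc_deriv (deriv_itv_eq fg Ix).
by case: eqP => // _; rewrite !fg.
Qed.

Lemma nc_deriv_horner p x y : I x -> I y ->
  nc_deriv (horner p) x y = (divided_diff p y).[x].
Proof.
move=> Ix Iy; rewrite /nc_deriv; case: eqVneq => [<-|xy].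
  rewrite deriv_itv_horner//.
  have := derivn_divided_diff p x 0; rewrite derivn1 => ->.
  by rewrite !hornerE subrr mulr0 add0r derivn0 mulr1n.
by rewrite -horner_divided_diff mulfK// subr_eq0.
Qed.

(** Symmetry of the divided difference. [counting_op] integrates over the second variable, so the
    quotient must be a polynomial in that one. *)
Lemma nc_deriv_hornerC p x y : I x -> I y ->
  nc_deriv (horner p) x y = (divided_diff p x).[y].
Proof.
move=> Ix Iy; rewrite -nc_deriv_horner// /nc_deriv [y == x]eq_sym.
by case: eqVneq => [->//|xy]; rewrite -[LHS]divrNN !opprB.
Qed.

Lemma cube_thead l (t : l.+1.-tuple R) : cube t -> I (thead t).
Proof. by move=> /(_ ord0). Qed.

Lemma cube_behead l (t : l.+1.-tuple R) : cube t -> cube [tuple of behead t].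
Proof.
move=> tI i; rewrite (_ : tnth _ i = tnth t (lift ord0 i)); first exact: tI.
by rewrite !(tnth_nth 0) /= nth_behead.
Qed.

Lemma cube_cons l u (r : l.-tuple R) : I u -> cube r -> cube [tuple of u :: r].
Proof.
move=> Iu rI i; case: (unliftP ord0 i) => [j|] ->; last by rewrite tnth0.
by rewrite tnthS; exact: rI.
Qed.

Lemma cube_behead2 l (t : l.+2.-tuple R) :
  cube t -> cube [tuple of behead (behead t)].
Proof.
by move=> /cube_behead/cube_behead; congr (cube _); exact/val_inj.
Qed.

Lemma nc_derivn_eq f g k (t : k.+1.-tuple R) : (forall y, I y -> f y = g y) ->
  cube t -> nc_derivn f k t = nc_derivn g k t.
Proof.
move=> fg; elim: k t => [|k IH] t tI /=; first by rewrite fg//; exact: cube_thead.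
apply: nc_deriv_eq.
- by move=> u Iu; apply: IH; apply: cube_cons => //; exact: cube_behead2.
- exact: cube_thead.
- exact/cube_thead/cube_behead.
Qed.

(* [nc_derivn] differentiates the first variable against the second, so the head of
   [s] is the last point at which a divided difference is taken. *)
Definition divided_diffs p (s : seq R) := foldr (fun y q => divided_diff q y) p s.

Lemma nc_derivn_horner p k (t : k.+1.-tuple R) : cube t ->
  nc_derivn (horner p) k t = (divided_diffs p (behead t)).[thead t].
Proof.
elim: k t => [|k IH] t tI.
  by rewrite /= (_ : behead t = [::])//; apply/size0nil; rewrite size_behead size_tuple.
set r := [tuple of behead (behead t)].
rewrite /= -/r (@nc_deriv_eq _ (horner (divided_diffs p r))); last 3 first.
- move=> u Iu; rewrite IH; last by apply: cube_cons => //; exact: cube_behead2.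
  by rewrite theadE.
- exact: cube_thead.
- exact/cube_thead/cube_behead.
rewrite nc_deriv_horner; last 2 first.
- exact: cube_thead.
- exact/cube_thead/cube_behead.
congr (horner _ _); rewrite {}/r; case/tupleP: t tI => u t _.
by case/tupleP: t => v t.
Qed.

Lemma divided_diffs_bound p k (s : k.-tuple R) M j : cube s ->
  (forall x, I x -> `|p^`(j + k).[x]| <= M) ->
  forall x, I x -> `|(divided_diffs p s)^`(j).[x]| <= M.
Proof.
elim: k s j => [|k IH] s j sI pM x Ix; first by rewrite tuple0/= -(addn0 j); exact: pM.
rewrite [tval s](_ : _ = thead s :: [tuple of behead s]); last by case/tupleP: s sI.
apply: divided_diff_bound => //; first exact: cube_thead.
move=> z Iz; rewrite -addSnnS in pM.
exact: (IH [tuple of behead s] j.+1 (cube_behead sI) pM z Iz).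
Qed.

Lemma nc_derivn_horner_bound p k M (t : k.+1.-tuple R) : cube t ->
  (forall x, I x -> `|p^`(k).[x]| <= M) -> `|nc_derivn (horner p) k t| <= M.
Proof.
move=> tI pM; rewrite nc_derivn_horner//.
have := @divided_diffs_bound p k [tuple of behead t] M 0 (cube_behead tI).
by rewrite derivn0; apply => //; exact: cube_thead.
Qed.
End derivative_on_itv.

(** * The expansion for polynomials *)

Section polynomial_expansion.
Context (R : realType).
Local Notation I := (@sym_itv R).
Local Notation mu := (tuple_measure (@semicircular R)).

(** With the next lemma, this translates [chebU_divdiff] over [{poly R}], taken at the indeterminate
    and at a constant, into a statement about polynomials over [R]. *)
Lemma horner_chebU_X n : (chebU {poly R} n).['X] = chebU R n.
Proof.
elim/nat_ind2: n => [||n IH1 IH2].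
- by rewrite !chebU0 hornerC.
- by rewrite !chebU1 hornerX.
- by rewrite !chebUSS hornerD hornerN hornerM hornerX IH1 IH2.
Qed.

Lemma horner_chebU_C n (y : R) : (chebU {poly R} n).[y%:P] = (chebU R n).[y]%:P.
Proof.
elim/nat_ind2: n => [||n IH1 IH2].
- by rewrite !chebU0 !hornerC.
- by rewrite !chebU1 !hornerX.
- rewrite !chebUSS !(hornerD, hornerN, hornerM, hornerX) IH1 IH2.
  by rewrite rmorphB rmorphM.
Qed.

Lemma divided_diff_chebU0 (y : R) : divided_diff (chebU R 0) y = 0.
Proof. by apply: divided_diff_uniq; rewrite mul0r chebU0 hornerC subrr. Qed.

Lemma divided_diff_chebU n (y : R) : divided_diff (chebU R n.+1) y =
  \sum_(i < n.+1) (chebU R (n - i)).[y] *: chebU R i.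
Proof.
apply: divided_diff_uniq.
have := chebU_divdiff n 'X (y%:P : {poly R}).
rewrite horner_chebU_X horner_chebU_C mulrC => ->; congr (_ * _).
apply: eq_bigr => i _; rewrite horner_chebU_X horner_chebU_C -mul_polyC mulrC.
by [].
Qed.

Lemma sum_triangle (G : nat -> nat -> R) n :
  \sum_(i < n.+1) \sum_(a < i.+1) G a (i - a)%N =
  \sum_(a < n.+1) \sum_(c < (n - a).+1) G a c.
Proof.
elim: n => [|n IH]; first by rewrite !big_ord1.
rewrite big_ord_recr/= IH [RHS]big_ord_recr/= subnn big_ord1.
rewrite [\sum_(a < n.+2) _]big_ord_recr/= subnn addrA; congr (_ + _).
rewrite -big_split/=; apply: eq_bigr => a _.
have an : (a <= n)%N by rewrite -ltnS.
by rewrite subSn// [in RHS]big_ord_recr.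
Qed.

Lemma chebU_itvE n x : I x -> chebU_itv n x = (chebU R n).[x].
Proof. by move=> Ix; rewrite /chebU_itv patchE mem_set. Qed.

Lemma chebU_tupleS l m (t : l.+1.-tuple R) : chebU_tuple m t =
  \sum_(i < m.+1) chebU_itv i (thead t) *
    chebU_tuple (m - i) ([tuple of behead t] : l.-tuple R).
Proof. by []. Qed.

(** Each divided difference splits one index into two and lowers the total by one. Since [b]
    vanishes from [N] on, the range [m < N] can stay the same while the coefficients shift by
    [k]. *)
Lemma nc_derivn_chebU N (b : nat -> R) k (t : k.+1.-tuple R) :
  (forall n, (N <= n)%N -> b n = 0) -> cube t ->
  nc_derivn (horner (\sum_(n < N) b n *: chebU R n)) k t =
  \sum_(m < N) b (m + k)%N * chebU_tuple m t.
Proof.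
move=> bN; elim: k t => [|k IH] t tI.
  rewrite /= horner_sum; apply: eq_bigr => m _; rewrite addn0 hornerZ; congr (_ * _).
  rewrite big_ord_recr/= subnn/= mulr1 chebU_itvE; last exact: cube_thead.
  rewrite big1 ?add0r// => i _; rewrite subn_eq0 leqNgt ltn_ord mulr0//.
set x := thead t; set y := thead [tuple of behead t].
set r : k.-tuple R := [tuple of behead (behead t)].
have Ix : I x by exact: cube_thead.
have Iy : I y by exact/cube_thead/cube_behead.
have rE : [tuple of behead [tuple of behead t]] = r by exact/val_inj.
pose P := \sum_(m < N) b (m + k)%N *:
  \sum_(i < m.+1) chebU_tuple (m - i) r *: chebU R i.
rewrite [LHS]/= -/x -/y (@nc_deriv_eq _ _ (horner P) _ _ _ Ix Iy); last first.
  move=> u Iu; rewrite -/r IH; last by apply: cube_cons => //; exact: cube_behead2.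
  rewrite horner_sum; apply: eq_bigr => m _; rewrite hornerZ horner_sum; congr (_ * _).
  rewrite chebU_tupleS; apply: eq_bigr => i _; rewrite hornerZ theadE chebU_itvE// mulrC.
  by congr (chebU_tuple _ _ * _); exact/val_inj.
rewrite nc_deriv_horner// /P divided_diff_sum horner_sum.
(* Common form of both sides: [a] and [c] are the indices at the first two variables, and the
   remaining ones add up to [m - (a + c)]. *)
pose S m := \sum_(a < m.+1) \sum_(c < (m - a).+1)
  (chebU R a).[x] * ((chebU R c).[y] * chebU_tuple (m - (a + c)) r).
have SE m : (divided_diff (\sum_(i < m.+2) chebU_tuple (m.+1 - i) r *: chebU R i) y).[x] = S m.
  rewrite divided_diff_sum big_ord_recl divided_diff_chebU0 scaler0 add0r /S.
  rewrite -(sum_triangle (fun a c => (chebU R a).[x] *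
    ((chebU R c).[y] * chebU_tuple (m - (a + c)) r))) horner_sum.
  apply: eq_bigr => i _; rewrite divided_diff_chebU hornerZ horner_sum mulr_sumr.
  apply: eq_bigr => a _; rewrite hornerZ subSS subnKC -1?ltnS//.
  by ring.
have SD m : chebU_tuple m t = S m.
  rewrite chebU_tupleS /S; apply: eq_bigr => a _.
  rewrite chebU_itvE// chebU_tupleS mulr_sumr; apply: eq_bigr => c _.
  by rewrite chebU_itvE// subnDA rE.
(* The shift by one: on the left the term of index 0 has zero divided difference, and on the right
   the last coefficient lies beyond the support of [b]. *)
case: N bN {P IH} => [|N] bN; first by rewrite !big_ord0.
have D0 : (divided_diff (\sum_(i < 1) chebU_tuple (0 - i) r *: chebU R i) y).[x] = 0.
  by rewrite divided_diff_sum big_ord1 divided_diff_chebU0 scaler0 horner0.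
under [RHS]eq_bigr do rewrite SD.
rewrite big_ord_recl hornerZ D0 mulr0 add0r [RHS]big_ord_recr/= (bN (N + k.+1)%N); last first.
  by rewrite addnS ltnS leq_addr.
rewrite mul0r addr0; apply: eq_bigr => m _.
by rewrite hornerZ SE; congr (b _ * _); rewrite /bump/= add1n addSnnS.
Qed.

Lemma nc_derivn_horner_restrict N (b : nat -> R) k :
  (forall n, (N <= n)%N -> b n = 0) ->
  (@nc_derivn R (horner (\sum_(n < N) b n *: chebU R n)) k) \_ (@cube R k.+1) =
  (fun t => \sum_(m < N) b (m + k)%N * chebU_tuple m t).
Proof.
move=> bN; apply/funext => t; rewrite patchE; case: ifPn => [/[1!inE] tI|].
  exact: nc_derivn_chebU.
rewrite notin_setE => tI; rewrite big1// => m _.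
have H l (s : l.-tuple R) j : ~ cube s -> chebU_tuple j s = 0.
  elim: l s j => [|l IH] s j sI; first by exfalso; apply: sI => -[].
  rewrite chebU_tupleS big1// => i _.
  have [Is|nIs] := pselect (I (thead s)); last first.
    by rewrite /chebU_itv patchE memNset// mul0r.
  rewrite IH ?mulr0// => rI; apply: sI; case/tupleP: s Is rI => u s.
  rewrite theadE => Iu rI; apply: cube_cons => //.
  by move: rI; congr (cube _); exact/val_inj.
by rewrite H ?mulr0.
Qed.


Lemma chebC_support_expansion (p : {poly R}) N : (size p <= N)%N ->
  exists2 c : nat -> R, (forall n, (N <= n)%N -> c n = 0) &
    p = \sum_(n < N) c n *: chebC R n.
Proof.
move=> /chebC_expansion[c ->]; exists (fun n => if (n < N)%N then c n else 0).
  by move=> n; rewrite leqNgt => /negbTE ->.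
by apply: eq_bigr => n _; rewrite ltn_ord.
Qed.

Lemma deriv_chebC_sum N (c : nat -> R) : (forall n, (N <= n)%N -> c n = 0) ->
  (\sum_(n < N) c n *: chebC R n)^`() =
  \sum_(n < N) (c n.+1 * n.+1%:R) *: chebU R n.
Proof.
case: N => [|N] cN; first by rewrite !big_ord0 derivC.
rewrite raddf_sum big_ord_recl/= [RHS]big_ord_recr/= (cN N.+1)// mul0r scale0r addr0.
rewrite derivZ chebC0 -polyC_natr derivC scaler0 add0r.
apply: eq_bigr => n _; rewrite derivZ /bump/= add1n chebC_deriv -polyC_natr.
by rewrite mul_polyC scalerA.
Qed.

Lemma bounded_measurable_nc_derivn_deriv (p : {poly R}) k :
  bounded_measurable ((@nc_derivn R (horner p^`()) k) \_ (@cube R k.+1)).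
Proof.
have [c cN ->] := chebC_support_expansion (leqnn (size p)).
rewrite deriv_chebC_sum// (@nc_derivn_horner_restrict _ (fun n => c n.+1 * n.+1%:R)).
  apply: bounded_measurable_sum => m; apply: bounded_measurableM.
    exact: bounded_measurable_cst.
  exact: bounded_measurable_chebU_tuple.
by move=> n Nn; rewrite cN ?mul0r// leqW.
Qed.

Lemma nc_derivn_deriv_itv (p : {poly R}) k :
  (@nc_derivn R (deriv_itv (horner p)) k) \_ (@cube R k.+1) =
  (@nc_derivn R (horner p^`()) k) \_ (@cube R k.+1).
Proof.
apply/funext => t; rewrite !patchE; case: ifPn => // /[1!inE] tI.
by apply: nc_derivn_eq => // y Iy; exact: deriv_itv_horner.
Qed.

(** The component of index [m] has squared norm ['C(m + k, k)] and coefficient [b (m + k)]. Putting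
    [n = m + k], the extra terms with [n < k] vanish by the binomial and those with [n >= N] by the
    support of [c]. *)
Lemma norm_alpha_chebC N (c : nat -> R) k (p := \sum_(n < N) c n *: chebC R n) :
  (forall n, (N <= n)%N -> c n = 0) ->
  norm_alpha (@nc_derivn R (deriv_itv (horner p)) k) ^+ 2 =
  \sum_(n < N) (c n.+1 * n.+1%:R) ^+ 2 * 'C(n, k)%:R.
Proof.
move=> cN; rewrite norm_alpha_sqr nc_derivn_deriv_itv; last first.
  exact: bounded_measurable_nc_derivn_deriv.
rewrite {}/p deriv_chebC_sum//.
pose b n := c n.+1 * n.+1%:R.
have bN n : (N <= n)%N -> b n = 0 by move=> Nn; rewrite /b cN ?mul0r// leqW.
rewrite (@nc_derivn_horner_restrict _ b)// (chebU_tuple_sqnorm k.+1 N (fun m => b (m + k)%N)).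
under eq_bigr do rewrite composition_numberE.
pose f n := b n ^+ 2 * 'C(n, k)%:R.
have fN n : (N <= n)%N -> f n = 0 by move=> /bN; rewrite /f => ->; rewrite expr0n mul0r.
transitivity (\sum_(0 <= n < N) f (n + k)%N); first by rewrite big_mkord.
transitivity (\sum_(0 <= n < N) f n); last by rewrite big_mkord.
transitivity (\sum_(0 <= n < N + k) f n); last first.
  rewrite (big_cat_nat (leq0n N) (leq_addr k N))/= [X in _ + X]big_nat_cond.
  by rewrite [X in _ + X]big1 ?addr0// => n /andP[/andP[/fN]].
rewrite [RHS](big_cat_nat (leq0n k) (leq_addl N k))/= [X in _ = X + _]big_nat_cond.
rewrite [X in _ = X + _]big1 ?add0r; last first.
  by move=> n /andP[/andP[_ nk] _]; rewrite /f bin_small// mulr0.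
have := @big_addn R 0 +%R 0 (N + k) k xpredT f.
by rewrite add0n addnK => ->.
Qed.

Lemma sum_signed_bin n L :
  \sum_(1 <= l < L.+1) (-1) ^+ l.-1 * 'C(n.+1, l)%:R = 1 - (-1) ^+ L * 'C(n, L)%:R :> R.
Proof.
elim: L => [|L IH]; first by rewrite big_geq// bin0 mulr1 subrr.
by rewrite big_nat_recr//= IH binS natrD exprS; ring.
Qed.

Lemma expansion_sum_chebC N (c : nat -> R) L (p := \sum_(n < N) c n *: chebC R n) :
  (forall n, (N <= n)%N -> c n = 0) ->
  \sum_(1 <= l < L.+1) expansion_term (horner p) l =
  \sum_(n < N) (c n.+1 ^+ 2 * n.+1%:R) * (1 - (-1) ^+ L * 'C(n, L)%:R).
Proof.
move=> cN; under [RHS]eq_bigr do rewrite -sum_signed_bin mulr_sumr.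
rewrite exchange_big/= big_nat_cond [RHS]big_nat_cond.
apply: eq_bigr => -[|l]// _; rewrite /expansion_term norm_alpha_chebC//= mulr_sumr.
apply: eq_bigr => n _.
(* The absorption identity turns the factor [n^2 'C(n - 1, l - 1) / l] into [n 'C(n, l)], which no
   longer contains the [1 / l] of the expansion. *)
have : n.+1%:R * 'C(n, l)%:R = l.+1%:R * 'C(n.+1, l.+1)%:R :> R.
  by rewrite -!natrM mul_bin_diag.
have : l.+1%:R != 0 :> R by rewrite pnatr_eq0.
move: (l.+1%:R : R) (n.+1%:R : R) ('C(n, l)%:R : R) ('C(n.+1, l.+1)%:R : R).
move=> l' n' B B' l0 e.
transitivity ((-1) ^+ l * c n.+1 ^+ 2 * n' * (n' * B) / l'); first by field.
by rewrite e; field.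
Qed.

Definition counting_poly (p : {poly R}) x : R :=
  arcsine_mean ('X * p^`()) + x * arcsine_mean p^`() -
  (4 - x ^+ 2) * arcsine_mean (divided_diff p^`() x).

Lemma counting_op_horner (p : {poly R}) x : I x ->
  counting_op (horner p) x = counting_poly p x.
Proof.
move=> Ix; rewrite /counting_op /counting_poly.
congr (_ + _ * _ - _ * _); apply: eq_Rintegral => y /[1!inE] Iy.
- by rewrite hornerM hornerX deriv_itv_horner.
- by rewrite deriv_itv_horner.
rewrite (@nc_deriv_eq _ _ (horner p^`()))// ?nc_deriv_hornerC//.
by move=> u Iu; rewrite deriv_itv_horner.
Qed.

Lemma counting_poly_sum N (c : nat -> R) x :
  counting_poly (\sum_(n < N) c n *: chebC R n) x =
  \sum_(n < N) c n * counting_poly (chebC R n) x.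
Proof.
elim: N => [|N IH].
  rewrite !big_ord0 /counting_poly derivC mulr0 !linear0 mulr0.
  rewrite (_ : divided_diff 0 x = 0) ?linear0 ?mulr0 ?addr0 ?subr0//.
  by apply: divided_diff_uniq; rewrite mul0r horner0 subr0.
rewrite [in LHS]big_ord_recr [in RHS]big_ord_recr/= -IH.
set p := \sum_(n < N) _; rewrite [p + _]addrC /counting_poly.
rewrite derivD derivZ divided_diff_is_linear mulrDr -scalerAr !linearP/=.
by rewrite /GRing.scale/=; ring.
Qed.

Lemma counting_poly_chebC0 x : counting_poly (chebC R 0) x = 0.
Proof.
rewrite /counting_poly chebC0 -polyC_natr derivC mulr0 !linear0.
rewrite (_ : divided_diff 0 x = 0) ?linear0 ?mulr0 ?addr0 ?subr0//.
by apply: divided_diff_uniq; rewrite mul0r horner0 subr0.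
Qed.

Lemma arcsine_mean_chebUSS n : arcsine_mean (chebU R n.+2) = arcsine_mean (chebU R n).
Proof.
have := arcsine_mean_chebC R n.+2; rewrite chebCB linearB/= mulr0 => /eqP.
by rewrite subr_eq0 => /eqP.
Qed.

(** [J m] is the mean of [u_m], [S m] the mean of its divided difference at [x], and [E n] is the
    image of [C_{n+1}] divided by [n + 1]. As [J] has period 2, [E] changes by
    [- (4 - x^2) u_{n+1}(x)] when [n] grows by 2, and by [chebU_mulC] so does [C_{n+1}(x)]. *)
Lemma counting_poly_chebCS n x :
  counting_poly (chebC R n.+1) x = n.+1%:R * (chebC R n.+1).[x].
Proof.
pose J m := arcsine_mean (chebU R m).
pose S m := \sum_(a < m) (chebU R (m.-1 - a)).[x] * J a.
pose E m := arcsine_mean ('X * chebU R m) + x * J m - (4 - x ^+ 2) * S m.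
have J0 : J 0%N = 1 by exact: arcsine_mean1.
have J1 : J 1%N = 0 by rewrite /J chebU1 -chebC1 arcsine_mean_chebC mulr0.
have -> : counting_poly (chebC R n.+1) x = n.+1%:R * E n.
  rewrite /counting_poly chebC_deriv -polyC_natr mul_polyC -scalerAr !linearZ/=.
  rewrite -[n.+1%:R *: chebU R n]addr0 divided_diff_is_linear.
  rewrite (_ : divided_diff 0 x = 0); last first.
    by apply: divided_diff_uniq; rewrite mul0r horner0 subr0.
  rewrite addr0 linearZ/= /GRing.scale/=.
  suff -> : arcsine_mean (divided_diff (chebU R n) x) = S n by rewrite /E /J; ring.
  case: n => [|n]; first by rewrite divided_diff_chebU0 linear0 /S big_ord0.
  by rewrite divided_diff_chebU linear_sum/=; apply: eq_bigr => a _; rewrite linearZ.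
congr (_ * _); elim/nat_ind2: n => [||n IH _].
- rewrite /E /S big_ord0 chebU0 mulr1 -chebC1 arcsine_mean_chebC J0 chebC1.
  by rewrite hornerX !mulr0 mulr1 add0r subr0.
- have X2 : 'X * chebU R 1 = chebC R 2 + 2 *: 1.
    rewrite chebCSS chebC1 chebC0 chebU1 -polyC1 -[2 *: _]mul_polyC polyC1.
    by rewrite mulr1 polyC_natr subrK.
  rewrite /E X2 linearD linearZ/= arcsine_mean1 arcsine_mean_chebC /S big_ord1 J0 J1.
  rewrite subnn chebU0 hornerC chebCSS chebC1 chebC0 hornerD hornerN hornerM hornerX.
  by rewrite -polyC_natr hornerC /GRing.scale/=; ring.
have SS : S n.+2 = (chebU R n.+1).[x] + S n.
  rewrite /S !big_ord_recl J0 J1 mulr0 add0r mulr1 subn0; congr (_ + _).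
  apply: eq_bigr => a _; congr (horner _ _ * _); last exact: arcsine_mean_chebUSS.
  by congr chebU; rewrite /= /bump/= !add1n; case: n {IH} a => [[]|n] // a.
have XS : arcsine_mean ('X * chebU R n.+2) = arcsine_mean ('X * chebU R n).
  apply/eqP; rewrite -subr_eq0 -linearB -mulrBr -chebCB; apply/eqP.
  rewrite (_ : 'X * _ = chebC R n.+3 + chebC R n.+1); last by rewrite (chebCSS _ n.+1) subrK.
  by rewrite linearD/= !arcsine_mean_chebC !mulr0 addr0.
rewrite /E XS SS /J arcsine_mean_chebUSS -/(J n).
have -> : (chebC R n.+3).[x] = (chebC R n.+1).[x] - (4 - x ^+ 2) * (chebU R n.+1).[x].
  have := congr1 (horner ^~ x) (chebU_mulC R n.+1).
  rewrite hornerM horner_4B hornerD hornerN => ->.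
  by rewrite opprB addrC subrK.
by rewrite -IH /E /J; ring.
Qed.

Lemma arcsine_mean_chebCM m n : arcsine_mean (chebC R m.+1 * chebC R n) =
  2 * (m.+1 == n)%:R.
Proof.
(* The second term is the correction for [C_0 = 2], whose squared norm is 4; the induction must pass
   through it. *)
have H i j : arcsine_mean (chebC R i * chebC R j) =
    2 * (i == j)%:R + 2 * ((i == 0) && (j == 0))%N%:R.
  elim: i j => [|i IH] j.
    rewrite chebC0 -polyC_natr mul_polyC linearZ/= arcsine_mean_chebC /GRing.scale/=.
    by case: j => [|j]; rewrite /= ?(mulr0, mulr1, addr0)//; ring.
  case: j => [|j].
    rewrite chebC0 mulrC -polyC_natr mul_polyC linearZ/= arcsine_mean_chebC.
    by rewrite /GRing.scale/= !mulr0 addr0.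
  have /(congr1 (@arcsine_mean R)) := chebCM R i j.
  rewrite !linearD/= IH !arcsine_mean_chebC mulr0 addr0 addn_eq0.
  by move=> /addIr ->; rewrite addr0 eqSS.
by rewrite H/= mulr0 addr0.
Qed.

Lemma inner_beta_chebC N (c : nat -> R) (p := \sum_(n < N) c n *: chebC R n) :
  (forall n, (N <= n)%N -> c n = 0) ->
  2^-1 * inner_beta (counting_op (horner p)) (horner p) =
  \sum_(n < N) c n.+1 ^+ 2 * n.+1%:R.
Proof.
move=> cN; pose q := \sum_(n < N) (c n.+1 * n.+1%:R) *: chebC R n.+1.
have -> : inner_beta (counting_op (horner p)) (horner p) = arcsine_mean (q * p).
  apply: eq_Rintegral => x /[1!inE] Ix; rewrite counting_op_horner// hornerM.
  congr (_ * _); rewrite /p counting_poly_sum /q horner_sum.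
  case: N @p @q cN => [|N] p q cN; first by rewrite !big_ord0.
  rewrite big_ord_recl [RHS]big_ord_recr/= hornerZ (cN N.+1)// !mul0r addr0.
  rewrite counting_poly_chebC0 mulr0 add0r; apply: eq_bigr => i _.
  by rewrite /bump/= counting_poly_chebCS hornerZ mulrA.
rewrite /q mulr_suml linear_sum mulr_sumr/=; apply: eq_bigr => n _.
rewrite -scalerAl linearZ/= /p mulr_sumr linear_sum/=.
have [nN|Nn] := ltnP n.+1 N.
  rewrite (bigD1 (Ordinal nN))//= big1 => [|m mn].
    rewrite -[chebC R n.+1 * _]scalerAr linearZ/= arcsine_mean_chebCM eqxx mulr1.
    rewrite addr0 /GRing.scale/=.
    by field.
  rewrite -[chebC R n.+1 * _]scalerAr linearZ/= arcsine_mean_chebCM.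
  rewrite (_ : _ == _ = false) ?mulr0 ?scaler0//; apply/eqP => e.
  by move/eqP: mn; apply; exact/val_inj.
by rewrite cN// mul0r scale0r mulr0 expr0n mul0r.
Qed.
End polynomial_expansion.

(** * Polynomial approximation of smooth functions *)

Section bernstein.
Context (R : realType).
Local Notation I := (@sym_itv R).

Let T : {poly R} := 4^-1 *: ('X + 2%:P).

(* De Casteljau's recursion: with [t = (x + 2) / 4], [(bernstein n g).[x]] is the sum
   of the [g k * 'C(n, k) * t^k * (1 - t)^(n - k)]. *)
Fixpoint bernstein n (g : nat -> R) : {poly R} :=
  if n is n'.+1 then (1 - T) * bernstein n' g + T * bernstein n' (fun k => g k.+1)
  else (g 0)%:P.

Let T_itv x : I x -> 0 <= T.[x] <= 1.
Proof.
by move=> /andP[? ?]; rewrite /T hornerZ hornerD hornerX hornerC; apply/andP; split; lra.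
Qed.

Let bernsteinS n g x : (bernstein n.+1 g).[x] =
  (1 - T.[x]) * (bernstein n g).[x] + T.[x] * (bernstein n (fun k => g k.+1)).[x].
Proof. by rewrite /= hornerD !hornerM hornerD hornerN hornerC. Qed.

Lemma le_bernstein n g h x : I x -> (forall k, (k <= n)%N -> g k <= h k) ->
  (bernstein n g).[x] <= (bernstein n h).[x].
Proof.
move=> Ix; have /andP[T0 T1] := T_itv Ix.
elim: n g h => [|n IH] g h gh; first by rewrite !hornerC gh.
rewrite !bernsteinS lerD// ler_wpM2l ?subr_ge0//; apply: IH => k kn.
  by rewrite gh// leqW.
by rewrite gh.
Qed.

Lemma bernstein_affine n (a b : R) g x :
  (bernstein n (fun k => a * g k + b)).[x] = a * (bernstein n g).[x] + b.
Proof.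
elim: n g => [|n IH] g; first by rewrite !hornerC.
by rewrite !bernsteinS !IH; ring.
Qed.

(** Squared bias plus the variance of a binomial variable. The centre [a] is arbitrary because the
    recursion replaces [k] by [k.+1], that is, [a] by [a - 1]. *)
Lemma bernstein_variance n (a : R) x :
  (bernstein n (fun k => (k%:R - a) ^+ 2)).[x] =
  (n%:R * T.[x] - a) ^+ 2 + n%:R * T.[x] * (1 - T.[x]).
Proof.
elim: n a => [|n IH] a; first by rewrite hornerC; ring.
rewrite bernsteinS IH.
rewrite (_ : (fun k => _) = (fun k : nat => (k%:R - (a - 1)) ^+ 2)); last first.
  by apply/funext => k; congr (_ ^+ 2); rewrite -natr1; ring.
by rewrite IH -natr1; ring.
Qed.

Lemma lipschitz_bernstein (f : R -> R) (L e : R) : 0 <= L -> 0 < e ->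
  (forall x y, I x -> I y -> `|f x - f y| <= L * `|x - y|) ->
  exists p : {poly R}, forall x, I x -> `|f x - p.[x]| <= e.
Proof.
move=> L0 e0 fL.
(* Two errors of at most [4 * L * d] will add up: one from the [d] in the bound on [|u|], one from
   the variance, which contributes at most [4 * L / (n * d)]; the choice [n >= d^-2] balances
   them. *)
have [d d0 de] : exists2 d, 0 < d & 8 * L * d <= e.
  exists (e / (8 * (L + 1))); first by rewrite divr_gt0// mulr_gt0// ltr_pwDr.
  rewrite mulrA ler_pdivrMr ?mulr_gt0 ?ltr_pwDr//.
  by rewrite mulrC ler_pM2l// mulrDr lerDl.
have [n n0 nd] : exists2 n, (0 < n)%N & (d ^+ 2)^-1 <= n%:R :> R.
  exists (Num.truncn (d ^+ 2)^-1).+1 => //.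
  by rewrite ltW// Num.Theory.truncnS_gt.
have n0' : 0 < n%:R :> R by rewrite ltr0n.
pose g k := f (4 * (k%:R / n%:R) - 2); exists (bernstein n g) => x Ix.
have /andP[T0 T1] := T_itv Ix.
have xE : x = 4 * T.[x] - 2 by rewrite /T hornerZ hornerD hornerX hornerC; field.
(* [|u| <= d + u^2 / d] turns the Lipschitz bound into the variance bound. *)
pose c := 4 * L / (n%:R ^+ 2 * d); pose v k : R := (k%:R - n%:R * T.[x]) ^+ 2.
have gx k : (k <= n)%N -> `|g k - f x| <= c * v k + 4 * L * d.
  move=> kn; have Ik : I (4 * (k%:R / n%:R) - 2).
    have k0 : 0 <= k%:R / n%:R :> R by rewrite divr_ge0.
    have k1 : k%:R / n%:R <= 1 :> R by rewrite ler_pdivrMr// mul1r ler_nat.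
    by apply/andP; split; lra.
  rewrite (le_trans (fL _ _ Ik Ix))// [in leLHS]xE.
  rewrite (_ : _ - _ - _ = 4 * ((k%:R - n%:R * T.[x]) / n%:R)); last by field; rewrite gt_eqF.
  set u := _ / n%:R; rewrite normrM ger0_norm//.
  have -> : c * v k = 4 * L * (u ^+ 2 / d).
    by rewrite /c /v /u; field; rewrite !gt_eqF.
  have -> : L * (4 * `|u|) = 4 * L * `|u| by ring.
  rewrite -mulrDr ler_wpM2l ?mulr_ge0//.
  have [ud|du] := leP `|u| d.
    by rewrite (le_trans ud)// lerDr divr_ge0 ?sqr_ge0// ltW.
  rewrite (@le_trans _ _ (u ^+ 2 / d))// ?lerDl ?(ltW d0)//.
  by rewrite ler_pdivlMr// -real_normK ?num_real// expr2 ler_wpM2l// ltW.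
have bv : c * (bernstein n v).[x] + 4 * L * d <= e.
  have -> : (bernstein n v).[x] = n%:R * T.[x] * (1 - T.[x]).
    by rewrite bernstein_variance subrr expr0n add0r.
  have dn : (n%:R * d)^-1 <= d.
    rewrite -[leLHS]mul1r ler_pdivrMr ?mulr_gt0//.
    rewrite (_ : d * _ = n%:R * d ^+ 2); last by ring.
    by rewrite -ler_pdivrMr ?exprn_gt0// div1r.
  have : c * (n%:R * T.[x] * (1 - T.[x])) <= 4 * L * d.
    rewrite (_ : c * _ = 4 * L * ((n%:R * d)^-1 * (T.[x] * (1 - T.[x])))); last first.
      by rewrite /c; field; rewrite !gt_eqF.
    rewrite ler_wpM2l ?mulr_ge0// (le_trans _ dn)// ler_piMr//.
      by rewrite invr_ge0 mulr_ge0// ltW.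
    by rewrite mulr_ile1 ?subr_ge0// lerBlDr lerDl.
  by move=> ?; lra.
(* The operator is monotone and commutes with affine maps, so the two-sided bound on the samples
   carries over to the polynomial; the factor [1 *] matches the shape of [bernstein_affine]. *)
have h1 := @le_bernstein n (fun k => 1 * g k + - f x) (fun k => c * v k + 4 * L * d) x Ix.
have h2 := @le_bernstein n (fun k => - c * v k + - (4 * L * d)) (fun k => 1 * g k + - f x) x Ix.
rewrite !bernstein_affine mul1r in h1 h2.
rewrite ler_norml; apply/andP; split.
  have /h1 : forall k, (k <= n)%N -> 1 * g k + - f x <= c * v k + 4 * L * d.
    by move=> k /gx; rewrite ler_norml mul1r => /andP[].
  lra.
have /h2 : forall k, (k <= n)%N -> - c * v k + - (4 * L * d) <= 1 * g k + - f x.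
  by move=> k /gx; rewrite ler_norml mul1r mulNr opprD => /andP[].
lra.
Qed.
End bernstein.

(** * Smooth functions on [[-2, 2]] as limits of polynomials, and convergence of divided
    differences *)

Section smooth_functions.
Context (R : realType).
Local Notation I := (@sym_itv R).
Implicit Types (f g h : R -> R) (p : {poly R}).

Lemma smooth_cvg f x : smooth_itv f -> I x ->
  diff_quotient f x y @[y --> within I x^'] --> deriv_itv f x.
Proof. by move=> /(_ 0%N x) sf Ix; exact: sf. Qed.

Lemma smooth_deriv_itv f : smooth_itv f -> smooth_itv (deriv_itv f).
Proof. by move=> sf n x Ix; rewrite -iterSr; exact: sf. Qed.

Lemma near_dnbhs_sym_itv x (P : R -> Prop) :
  (\forall y \near within I x^', P y) -> \forall y \near x, y != x -> I y -> P y.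
Proof. by []. Qed.

Lemma diff_quotient_continuous h (h' : R -> R) :
  (forall x, I x -> diff_quotient h x y @[y --> within I x^'] --> h' x) ->
  {within I, continuous h}.
Proof.
move=> hd; apply/subspace_continuousP => x Ix.
have : h x + diff_quotient h x y * (y - x) @[y --> within I x^'] --> h x + h' x * (x - x).
  apply: cvgD; first exact: cvg_cst.
  apply: cvgM; first exact: hd.
  apply: cvgB; last exact: cvg_cst.
  by apply: cvg_trans (@nbhs_dnbhs _ x); exact: cvg_within.
rewrite subrr mulr0 addr0 => hc.
apply/cvgrPdist_lt => e e0; move/cvgrPdist_lt : hc => /(_ e e0).
move=> /near_dnbhs_sym_itv H.
suff : \forall y \near x, I y -> `|h x - h y| < e by [].
apply: filterS H => y yP Iy; have [->|yx] := eqVneq y x; first by rewrite subrr normr0.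
by have := yP yx Iy; rewrite /diff_quotient divfK ?subr_eq0// [h x + _]addrC subrK.
Qed.

(** At interior points the limit within the interval is an ordinary derivative, shown in
    Caratheodory's form; at the endpoints the mean value theorem asks only for continuity. *)
Lemma diff_quotient_MVT h (h' : R -> R) M :
  (forall x, I x -> diff_quotient h x y @[y --> within I x^'] --> h' x) ->
  (forall x, I x -> `|h' x| <= M) ->
  forall x y, I x -> I y -> `|h x - h y| <= M * `|x - y|.
Proof.
move=> hd hM.
have H x y : I x -> I y -> x <= y -> `|h y - h x| <= M * `|y - x|.
  move=> /andP[x1 x2] /andP[y1 y2] xy.
  have hder (z : R) : z \in `]x, y[ -> is_derive z 1 h (h' z).
    rewrite in_itv/= => /andP[zx zy].
    have Iz : I z by apply/andP; split; lra.
    apply/is_derive1_caratheodory.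
    exists (fun u => if u == z then h' z else diff_quotient h z u); split.
    - move=> u; have [->|uz] := eqVneq u z; first by rewrite !subrr mulr0.
      by rewrite /diff_quotient divfK ?subr_eq0.
    - apply/cvgrPdist_lt => e e0; move/cvgrPdist_lt : (hd z Iz) => /(_ e e0).
      move=> /near_dnbhs_sym_itv K; rewrite eqxx.
      have In : \forall u \near z, I u.
        have : z \in `](-2)%R, 2%R[ by rewrite in_itv/=; apply/andP; split; lra.
        move=> /near_in_itvoo; apply: filterS => u; rewrite in_itv/= => /andP[? ?].
        by apply/andP; split; exact: ltW.
      apply: filterS2 K In => u Ku Iu.
      by case: (eqVneq u z) => [_|uz]; [rewrite subrr normr0|exact: Ku].
    - by rewrite eqxx.
  have hcont : {within `[x, y], continuous h}.
    apply: (@continuous_subspaceW _ _ _ I); last exact: diff_quotient_continuous hd.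
    by move=> z; rewrite /= in_itv/= => /andP[? ?]; apply/andP; split; lra.
  have [c cxy ->] := @MVT_segment R h h' x y xy hder hcont.
  rewrite normrM ler_wpM2r// hM//.
  by move: cxy; rewrite in_itv/= => /andP[? ?]; apply/andP; split; lra.
move=> x y Ix Iy; have [/(H _ _ Ix Iy)|/ltW/(H _ _ Iy Ix)//] := leP x y.
by rewrite distrC [X in _ * X]distrC.
Qed.

Lemma smooth_bounded f : smooth_itv f ->
  exists2 M, 0 <= M & forall x, I x -> `|f x| <= M.
Proof.
move=> sf; have cf : {within `[(-2)%R, 2%R], continuous f}.
  by rewrite -sym_itvE; apply: diff_quotient_continuous => x Ix; exact: smooth_cvg.
have l22 : -2 <= 2 :> R by lra.
have [c1 _ h1] := EVT_max l22 cf; have [c2 _ h2] := EVT_min l22 cf.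
exists (`|f c1| + `|f c2|) => [|x Ix]; first by rewrite addr_ge0.
have xI : x \in `[(-2)%R, 2%R] by rewrite in_itv.
rewrite ler_norml; apply/andP; split.
  rewrite (le_trans _ (h2 _ xI))// lerNl (le_trans (ler_norm _))// normrN.
  by rewrite lerDr.
by rewrite (le_trans (h1 _ xI))// (le_trans (ler_norm _))// lerDl.
Qed.

Lemma poly_primitive p : exists q : {poly R}, q^`() = p.
Proof.
exists (\poly_(i < (size p).+1) (p`_i.-1 / i%:R)); apply/polyP => i.
rewrite coef_deriv coef_poly ltnS; case: ltnP => [_|/(nth_default 0)->].
  by rewrite -[LHS]mulr_natr divfK ?pnatr_eq0.
by rewrite mul0rn.
Qed.

(** Induction on the number of derivatives: a primitive of an approximation of [f'] approximates [f]
    and keeps the estimates already obtained. In the base case a bound on [f'] makes [f] Lipschitz,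
    as Bernstein approximation requires. *)
Lemma smooth_poly_approx f K (e : R) : smooth_itv f -> 0 < e ->
  exists p, forall j x, (j <= K)%N -> I x ->
    `|iter j (@deriv_itv R) f x - p^`(j).[x]| <= e.
Proof.
elim: K f e => [|K IH] f e sf e0.
  have [L L0 fL] := smooth_bounded (smooth_deriv_itv sf).
  have [p pf] := lipschitz_bernstein L0 e0
    (diff_quotient_MVT (fun x => @smooth_cvg f x sf) fL).
  by exists p => -[|//] x _ Ix; rewrite derivn0; exact: pf.
(* Every point is within 2 of the base point 0, so an error [e / 4] on the derivative costs at most
   [e / 2] on the function. *)
have e4 : 0 < e / 4 by rewrite divr_gt0.
have [q qf] := IH _ _ (smooth_deriv_itv sf) e4.
have [Q QE] := poly_primitive q.
pose p := Q + (f 0 - Q.[0])%:P.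
have pE : p^`() = q by rewrite derivD derivC addr0.
exists p => -[|j] x jK Ix; last first.
  by rewrite iterSr derivSn pE (le_trans (qf _ _ jK Ix))// ler_pdivrMr// ler_pMr ?ler1n.
have I0 : I 0 by apply/andP; split; lra.
rewrite derivn0 /=; pose h u := f u - p.[u].
have h0 : h 0 = 0 by rewrite /h /p hornerD hornerC; ring.
have hd u : I u -> diff_quotient h u y @[y --> within I u^'] -->
    deriv_itv f u - q.[u].
  move=> Iu.
  have -> : (fun y => diff_quotient h u y) =
      (fun y => diff_quotient f u y - diff_quotient (horner p) u y).
    by apply/funext => y; rewrite /diff_quotient /h -mulrBl; congr (_ / _); ring.
  apply: cvgB; first exact: smooth_cvg.
  have [M _ pM] := horner_bounded p^`(2); rewrite -pE.
  by apply: (cvg_diff_quotient Iu (M := M)) => y Iy; exact: poly_taylor2.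
have := @diff_quotient_MVT h (fun u => deriv_itv f u - q.[u]) (e / 4) hd.
move=> /(_ _ x 0 Ix I0); rewrite h0 !subr0; move=> hx.
apply: le_trans (hx _) _; first by move=> u Iu; have := qf 0%N u isT Iu; rewrite derivn0.
have : `|x| <= 2 by rewrite ler_norml; move/andP: Ix => [-> ->].
by move=> x2; rewrite -mulrA ler_piMr ?(ltW e0)// mulrC ler_pdivrMr// mul1r (le_trans x2)// ler_nat.
Qed.

Lemma smooth_poly_seq f K : smooth_itv f -> exists (p : nat -> {poly R}) (M : R),
  (forall n j x, (j <= K)%N -> I x -> `|(p n)^`(j).[x]| <= M) /\
  (forall j x, (j <= K)%N -> I x ->
    (p n)^`(j).[x] @[n --> \oo] --> iter j (@deriv_itv R) f x).
Proof.
move=> sf.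
have /choice[p pE] : forall n : nat, exists p, forall j x, (j <= K)%N -> I x ->
    `|iter j (@deriv_itv R) f x - p^`(j).[x]| <= n.+1%:R^-1.
  by move=> n; apply: smooth_poly_approx => //; rewrite invr_gt0.
have [M M0 fM] : exists2 M, 0 <= M & forall j x, (j <= K)%N -> I x ->
    `|iter j (@deriv_itv R) f x| <= M.
  elim: K {pE} => [|K [M M0 IH]].
    have [M M0 fM] := smooth_bounded sf; exists M => // -[|//] x _; exact: fM.
  have sK : smooth_itv (iter K.+1 (@deriv_itv R) f).
    by move=> n x Ix; rewrite -iterD; exact: sf.
  have [N N0 fN] := smooth_bounded sK; exists (M + N); first exact: addr_ge0.
  move=> j x; rewrite leq_eqVlt => /predU1P[-> Ix|jK Ix].
    by rewrite (le_trans (fN _ Ix))// lerDr.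
  by rewrite (le_trans (IH _ _ jK Ix))// lerDl.
exists p, (M + 1); split.
  move=> n j x jK Ix; rewrite -[_.[x]](subrK (iter j (@deriv_itv R) f x)).
  rewrite (le_trans (ler_normD _ _))// addrC lerD ?fM// distrC.
  by rewrite (le_trans (pE _ _ _ jK Ix))// invf_le1// ler1n.
move=> j x jK Ix; apply/cvgrPdist_le => e e0.
have := @cvg_harmonic R => /cvgrPdist_le/(_ _ e0); apply: filterS => n.
rewrite sub0r normrN ger0_norm ?harmonic_ge0//; apply: le_trans.
exact: pE.
Qed.

(* A uniform [C^2] bound makes Taylor's estimate uniform in [n], so the derivatives are
   Cauchy and the estimate survives in the limit. *)
Lemma deriv_itv_cvg (P : nat -> {poly R}) f M :
  (forall n x, I x -> `|(P n)^`(2).[x]| <= M) ->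
  (forall x, I x -> (P n).[x] @[n --> \oo] --> f x) ->
  forall x, I x -> (P n)^`().[x] @[n --> \oo] --> deriv_itv f x.
Proof.
move=> PM Pf x Ix; pose a n := (P n)^`().[x].
have aP n y : I y -> `|(P n).[y] - (P n).[x] - a n * (y - x)| <= M * (y - x) ^+ 2.
  by move=> Iy; apply: poly_taylor2 => // z; exact: PM.
have M0 : 0 <= M by exact: le_trans (PM 0%N x Ix).
have : cvg (a @ \oo).
  apply/cauchy_cvgP/cauchy_exP => e e0.
  have d0 : 0 < e / 2 / (M + 1) by rewrite !divr_gt0// ltr_pwDr.
  have [y [Iy yx yd]] := sym_itv_limit_point Ix d0.
  have yx0 : y - x != 0 by rewrite subr_eq0.
  (* The centre of the Cauchy ball is a difference quotient of the limit: half of [e] pays for the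
     convergence of the quotients at this fixed [y], the other half for the Taylor error, uniform in
     [n]. *)
  exists ((f y - f x) / (y - x)).
  have : ((P n).[y] - (P n).[x]) / (y - x) @[n --> \oo] --> (f y - f x) / (y - x).
    by apply: cvgM; [apply: cvgB; exact: Pf|exact: cvg_cst].
  have e2 : 0 < e / 2 by rewrite divr_gt0.
  move=> /cvgrPdist_lt/(_ _ e2); rewrite /fmap/=; apply: filterS => n hn.
  rewrite /ball/= -[X in `|X - _|](subrK (((P n).[y] - (P n).[x]) / (y - x))).
  rewrite -addrA (le_lt_trans (ler_normD _ _))// [ltRHS](splitr e) ltr_leD//.
  have -> : ((P n).[y] - (P n).[x]) / (y - x) - a n =
      ((P n).[y] - (P n).[x] - a n * (y - x)) / (y - x) by field.
  rewrite normrM normfV ler_pdivrMr ?normr_gt0// (le_trans (aP _ _ Iy))//.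
  rewrite -real_normK ?num_real// expr2 mulrA ler_wpM2r//.
  rewrite (@le_trans _ _ ((M + 1) * `|y - x|))//.
    by rewrite ler_wpM2r// lerDl.
  by rewrite -ler_pdivlMl ?ltr_pwDr// mulrC.
move=> /cvg_ex[l al]; suff -> : deriv_itv f x = l by exact: al.
apply: (deriv_itvE Ix); apply: (cvg_diff_quotient Ix (M := M)) => y Iy.
have : (P n).[y] - (P n).[x] - a n * (y - x) @[n --> \oo] --> f y - f x - l * (y - x).
  apply: cvgB; first by apply: cvgB; exact: Pf.
  by apply: cvgM; [exact: al|exact: cvg_cst].
by move=> /cvgn_norm_le; apply=> n; exact: aP.
Qed.

Lemma nc_deriv_cvg (P : nat -> {poly R}) f M :
  (forall n x, I x -> `|(P n)^`(2).[x]| <= M) ->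
  (forall x, I x -> (P n).[x] @[n --> \oo] --> f x) ->
  forall x y, I x -> I y ->
    nc_deriv (horner (P n)) x y @[n --> \oo] --> nc_deriv f x y.
Proof.
move=> PM Pf x y Ix Iy; rewrite /nc_deriv; case: eqP => _.
  under eq_fun do rewrite deriv_itv_horner//.
  exact: deriv_itv_cvg PM Pf _ Ix.
by apply: cvgM; [apply: cvgB; exact: Pf|exact: cvg_cst].
Qed.

(** With the other variables frozen, the [k]-th divided differences are polynomials that converge
    pointwise by induction. Their second derivatives are bounded through order [k + 2] of [p n],
    which is why [K] must exceed the order reached. *)
Lemma nc_derivn_cvg (p : nat -> {poly R}) f M K :
  (forall n j x, (j <= K)%N -> I x -> `|(p n)^`(j).[x]| <= M) ->
  (forall x, I x -> (p n).[x] @[n --> \oo] --> f x) ->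
  forall k (t : k.+1.-tuple R), (k < K)%N -> cube t ->
    nc_derivn (horner (p n)) k t @[n --> \oo] --> nc_derivn f k t.
Proof.
move=> pM pf; elim=> [|k IH] t kK tI; first by apply: pf; exact: cube_thead.
set r : k.-tuple R := [tuple of behead (behead t)].
have rI : cube r by exact: cube_behead2.
have Ix := cube_thead tI; have Iy := cube_thead (cube_behead tI).
pose F u := nc_derivn f k [tuple of u :: r].
have -> : (fun n => nc_derivn (horner (p n)) k.+1 t) =
    (fun n => nc_deriv (horner (divided_diffs (p n) r))
      (thead t) (thead [tuple of behead t])).
  apply/funext => n; apply: nc_deriv_eq => // u Iu.
  transitivity (nc_derivn (horner (p n)) k [tuple of u :: r]) => //.
  rewrite nc_derivn_horner; last exact: cube_cons.
  by rewrite theadE.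
apply: (@nc_deriv_cvg _ F M) => //.
- move=> n x Ixx; apply: divided_diffs_bound => // z Iz.
  by apply: pM.
- move=> x Ixx; have := IH [tuple of x :: r] (ltnW kK) (cube_cons Ixx rI).
  apply: cvg_trans; apply: near_eq_cvg; apply: nearW => n.
  rewrite nc_derivn_horner; last exact: cube_cons.
  by rewrite theadE.
Qed.
End smooth_functions.

(** * Passage to the limit *)

Section limit.
Context (R : realType).
Local Notation I := (@sym_itv R).
Local Notation mu := (tuple_measure (@semicircular R)).

Definition expansion_sum (f : R -> R) L : R :=
  \sum_(1 <= l < L.+1) expansion_term f l.

Definition half_counting_form (f : R -> R) : R := 2^-1 * inner_beta (counting_op f) f.

(** The weights are [n c_n^2] with the index shifted by one. Their sign yields the inequalities, and
    their vanishing beyond the degree yields the cases of equality. *)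
Lemma expansion_sumB_horner (p : {poly R}) L : exists2 w : nat -> R,
  (forall n, 0 <= w n) /\ (forall n, (size p <= n.+1)%N -> w n = 0) &
  expansion_sum (horner p) L - half_counting_form (horner p) =
    - (-1) ^+ L * \sum_(n < size p) w n * 'C(n, L)%:R.
Proof.
have [c cN pE] := chebC_support_expansion (leqnn (size p)).
exists (fun n => c n.+1 ^+ 2 * n.+1%:R).
  split=> n; first by rewrite mulr_ge0 ?sqr_ge0.
  by move=> /cN ->; rewrite expr0n mul0r.
rewrite /expansion_sum /half_counting_form {1 2 3}pE expansion_sum_chebC//.
rewrite inner_beta_chebC// -sumrB mulr_sumr; apply: eq_bigr => n _; ring.
Qed.

Lemma expansion_sum_horner_sign (p : {poly R}) L :
  (-1) ^+ L * (expansion_sum (horner p) L - half_counting_form (horner p)) <= 0.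
Proof.
have [w [w0 _] ->] := expansion_sumB_horner p L.
rewrite mulNr mulrN mulrA -expr2 sqrr_sign mul1r oppr_le0.
by apply: sumr_ge0 => n _; rewrite mulr_ge0.
Qed.

(** In degree at most [L], every [n] with nonzero weight satisfies [n < L], and then
    ['C(n, L) = 0]. *)
Lemma expansion_sum_horner_eq (p : {poly R}) L : (size p <= L.+1)%N ->
  expansion_sum (horner p) L = half_counting_form (horner p).
Proof.
move=> pL; have [w [_ w0] e] := expansion_sumB_horner p L.
apply/eqP; rewrite -subr_eq0 e big1 ?mulr0// => n _.
have [/w0->|np] := leqP (size p) n.+1; first by rewrite mul0r.
by rewrite bin_small ?mulr0// -ltnS (leq_trans np).
Qed.

(** The limit is measurable and bounded as a pointwise limit of uniformly bounded measurable
    functions, so no joint regularity of [nc_derivn f] has to be established beforehand. *)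
Lemma cvg_norm_alpha_sqr (F : nat -> R -> R) (f : R -> R) k M :
  (forall n, bounded_measurable ((@nc_derivn R (F n) k) \_ (@cube R k.+1))) ->
  (forall n t, cube t -> `|nc_derivn (F n) k t| <= M) ->
  (forall t : k.+1.-tuple R, cube t ->
    nc_derivn (F n) k t @[n --> \oo] --> nc_derivn f k t) ->
  norm_alpha (@nc_derivn R (F n) k) ^+ 2 @[n --> \oo] -->
  norm_alpha (@nc_derivn R f k) ^+ 2.
Proof.
move=> bF FM Ff; pose G n := (@nc_derivn R (F n) k) \_ (@cube R k.+1).
pose g := (@nc_derivn R f k) \_ (@cube R k.+1).
have GM n t : `|G n t| <= `|M|.
  rewrite /G patchE; case: ifPn => [/[1!inE] tI|_]; last by rewrite normr0.
  by rewrite (le_trans (FM _ _ tI))// ler_norm.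
have Gg t : G n t @[n --> \oo] --> g t.
  rewrite /G /g; under eq_fun do rewrite patchE; rewrite patchE.
  by case: ifPn => [/[1!inE] tI|_]; [exact: Ff|exact: cvg_cst].
have bg : bounded_measurable g.
  split; last by exists `|M| => t; exact: cvgn_norm_le (Gg t) (GM ^~ t).
  by apply: (measurable_fun_cvg (h := G)) => [n|t _]; [case: (bF n)|exact: Gg].
rewrite (norm_alpha_sqr bg).
under eq_fun => n do rewrite (norm_alpha_sqr (bF n)).
apply: (@bounded_cvg_Rintegral _ _ R (mu k.+1) setT measurableT _
  (fun n t => G n t ^+ 2) (fun t => g t ^+ 2) (`|M| ^+ 2)).
- exact: finite_measure_lty.
- by move=> n; apply: measurable_funX; case: (bF n).
- by move=> n t _; rewrite normrX lerXn2r ?nnegrE.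
- by move=> t _; apply: cvgM; exact: Gg.
Qed.

Lemma arcsine_mean_bound (p : {poly R}) M :
  (forall x, I x -> `|p.[x]| <= M) -> `|arcsine_mean p| <= M.
Proof.
move=> pM; have mI := @measurable_sym_itv R.
apply: le_trans (@le_normr_Rintegral _ (measurableTypeR R) R arcsine I (horner p) mI
  (@integrable_horner R p)) _.
have -> : M = \int[arcsine]_(x in I) M.
  rewrite Rintegral_cst//; transitivity (M * fine (@arcsine R I)) => //.
  by rewrite arcsine_sym_itv mulr1.
apply: le_Rintegral => //; first exact: integrable_norm (@integrable_horner R p).
apply: (@bounded_integrable _ _ R arcsine I mI (arcsine_sym_itv_lty R) (cst M) `|M|) => //.
Qed.

(** Serves the measurability in [x] of the integrand of the quadratic form. *)
Lemma counting_poly_horner (p : {poly R}) :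
  exists q : {poly R}, forall x, counting_poly p x = q.[x].
Proof.
have [c cN ->] := chebC_support_expansion (leqnn (size p)).
exists (\sum_(n < size p) (c n * n%:R) *: chebC R n) => x.
rewrite counting_poly_sum horner_sum; apply: eq_bigr => -[[|n] /= _] _.
  by rewrite counting_poly_chebC0 !mulr0 scale0r horner0.
by rewrite counting_poly_chebCS hornerZ mulrA.
Qed.

Lemma cvg_arcsine_mean (q : nat -> {poly R}) (g : R -> R) M :
  (forall n x, I x -> `|(q n).[x]| <= M) ->
  (forall x, I x -> (q n).[x] @[n --> \oo] --> g x) ->
  arcsine_mean (q n) @[n --> \oo] --> \int[arcsine]_(x in I) g x.
Proof.
move=> qM qg; apply: (@bounded_cvg_Rintegral _ _ R arcsine I
  (@measurable_sym_itv R) (arcsine_sym_itv_lty R) (fun n => horner (q n)) g M) => //.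
by move=> n; apply: measurable_funTS; exact: measurable_horner.
Qed.

Section sequence.
Variables (p : nat -> {poly R}) (f : R -> R) (M : R) (K : nat).
Hypothesis pM : forall n j x, (j <= K)%N -> I x -> `|(p n)^`(j).[x]| <= M.
Hypothesis pf : forall j x, (j <= K)%N -> I x ->
  (p n)^`(j).[x] @[n --> \oo] --> iter j (@deriv_itv R) f x.

(** The last term takes [L - 1] divided differences of [p'], bounded through order [L]; the diagonal
    limit in its last divided difference asks for one derivative more. *)
Lemma cvg_expansion_sum L : (L < K)%N ->
  expansion_sum (horner (p n)) L @[n --> \oo] --> expansion_sum f L.
Proof.
move=> LK; have cl l : (0 < l <= L)%N ->
    expansion_term (horner (p n)) l @[n --> \oo] --> expansion_term f l.
  case: l => [//|l] /= lL; rewrite /expansion_term /=.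
  apply: cvgM; first exact: cvg_cst.
  apply: (@cvg_norm_alpha_sqr _ _ _ M).
  - move=> n; rewrite nc_derivn_deriv_itv.
    exact: bounded_measurable_nc_derivn_deriv.
  - move=> n t tI; rewrite (@nc_derivn_eq _ _ (horner (p n)^`()))//; last first.
      by move=> y Iy; exact: deriv_itv_horner.
    apply: nc_derivn_horner_bound => // x Ix; rewrite -derivSn; apply: pM => //.
    by rewrite (leq_trans lL)// ltnW.
  - move=> t tI; have -> : (fun n => nc_derivn (deriv_itv (horner (p n))) l t) =
        (fun n => nc_derivn (horner (p n)^`()) l t).
      apply/funext => n; apply: nc_derivn_eq => // y Iy; exact: deriv_itv_horner.
    apply: (@nc_derivn_cvg _ (fun n => (p n)^`()) _ M K.-1) => //.
    + move=> n j x jK Ix; rewrite -derivSn; apply: pM => //.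
      by case: (K) jK LK => // K' jK' _.
    + move=> x Ix; have := @pf 1 x (leq_ltn_trans (leq0n L) LK) Ix.
      by under eq_fun do rewrite derivn1.
    + by rewrite (leq_trans lL)// -ltnS (leq_trans LK)// leqSpred.
rewrite /expansion_sum; elim: L LK cl => [|L IH] LK cl.
  by rewrite big_geq//; under eq_fun do rewrite big_geq//; exact: cvg_cst.
rewrite big_nat_recr//=; under eq_fun do rewrite big_nat_recr//=.
apply: cvgD; last by apply: cl; rewrite leqnn.
apply: IH; first exact: ltnW.
by move=> l /andP[l0 lL]; apply: cl; rewrite l0 leqW.
Qed.

(** [counting_op] takes a divided difference of [p'], whose limit on the diagonal requires a uniform
    bound on the second derivative of [p']: hence three derivatives. *)
Lemma cvg_half_counting_form : (3 <= K)%N ->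
  half_counting_form (horner (p n)) @[n --> \oo] --> half_counting_form f.
Proof.
move=> K3; apply: cvgM; first exact: cvg_cst.
have p1M n x : I x -> `|(p n)^`().[x]| <= M.
  by move=> Ix; rewrite -derivn1; apply: pM => //; exact: leq_trans K3.
have p2M n x : I x -> `|(p n)^`()^`().[x]| <= M.
  by move=> Ix; have := @pM n 2 x (ltnW K3) Ix; rewrite derivSn derivn1.
have p3M n x : I x -> `|(p n)^`()^`(2).[x]| <= M.
  by move=> Ix; have := @pM n 3 x K3 Ix; rewrite derivSn.
have p1f x : I x -> (p n)^`().[x] @[n --> \oo] --> deriv_itv f x.
  move=> Ix; have := @pf 1 x (leq_trans (isT : 0 < 3)%N K3) Ix.
  by under eq_fun do rewrite derivn1.
have p0f x : I x -> (p n).[x] @[n --> \oo] --> f x by move=> Ix; exact: (@pf 0).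
have p0M n x : I x -> `|(p n).[x]| <= M.
  by move=> Ix; have := @pM n 0 x (leq0n K) Ix; rewrite derivn0.
have x2 x : I x -> `|x| <= 2 by move=> /andP[? ?]; rewrite ler_norml; apply/andP.
have XM n x : I x -> `|('X * (p n)^`()).[x]| <= 2 * M.
  by move=> Ix; rewrite hornerM hornerX normrM ler_pM ?x2 ?p1M.
have DM x n y : I x -> I y -> `|(divided_diff (p n)^`() x).[y]| <= M.
  move=> Ix Iy; have := @divided_diff_bound _ (p n)^`() x M 0 Ix.
  by rewrite derivn0 derivn1; apply => // z Iz; exact: p2M.
pose cp n x := counting_poly (p n) x.
have cpf x : I x -> cp n x @[n --> \oo] --> counting_op f x.
  move=> Ix; apply: cvgB; first apply: cvgD.
  - apply: (cvg_arcsine_mean XM) => y Iy.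
    by under eq_fun do rewrite hornerM hornerX; apply: cvgM; [exact: cvg_cst|exact: p1f].
  - by apply: cvgM; [exact: cvg_cst|exact: (cvg_arcsine_mean p1M)].
  - apply: cvgM; first exact: cvg_cst.
    apply: (cvg_arcsine_mean (fun n y => @DM x n y Ix)) => y Iy.
    have := nc_deriv_cvg p3M p1f Ix Iy; apply: cvg_trans.
    by apply: near_eq_cvg; apply: nearW => n; rewrite nc_deriv_hornerC.
have cpM n x : I x -> `|cp n x| <= 8 * M.
  move=> Ix; have h1 := arcsine_mean_bound (XM n).
  have h2 := arcsine_mean_bound (p1M n).
  have h3 := arcsine_mean_bound (fun y => @DM x n y Ix).
  have h4 : `|4 - x ^+ 2| <= 4.
    have := x2 x Ix; move/andP: Ix => [? ?] _.
    by rewrite ler_norml; apply/andP; split; nra.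
  rewrite /cp /counting_poly (le_trans (ler_normB _ _))//.
  rewrite (_ : 8 * M = 2 * M + 2 * M + 4 * M); last by ring.
  rewrite lerD//; last by rewrite normrM ler_pM.
  by rewrite (le_trans (ler_normD _ _))// lerD// normrM ler_pM// x2.
rewrite /inner_beta.
have -> : (fun n => \int[arcsine]_(x in I) (counting_op (horner (p n)) x * (p n).[x])) =
    (fun n => \int[arcsine]_(x in I) (cp n x * (p n).[x])).
  by apply/funext => n; apply: eq_Rintegral => x /[1!inE] Ix; rewrite counting_op_horner.
apply: (@bounded_cvg_Rintegral _ _ R arcsine I
  (@measurable_sym_itv R) (arcsine_sym_itv_lty R) _ _ (8 * M * M)).
- move=> n; apply: measurable_funTS; have [q qE] := counting_poly_horner (p n).
  have -> : (fun x => cp n x * (p n).[x]) = horner (q * p n).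
    by apply/funext => x; rewrite hornerM /cp qE.
  exact: measurable_horner.
- by move=> n x Ix; rewrite normrM ler_pM// ?cpM ?p0M.
- by move=> x Ix; apply: cvgM; [exact: cpf|exact: p0f].
Qed.
End sequence.

(** The sign factor lets one inequality cover both parities of [L]. The order [L + 3] meets the
    requirements of both convergence lemmas. *)
Lemma expansion_sum_sign (f : R -> R) L : smooth_itv f ->
  (-1) ^+ L * (expansion_sum f L - half_counting_form f) <= 0.
Proof.
move=> sf; have [p [M [pM pf]]] := smooth_poly_seq (L + 3) sf.
have cS := cvg_expansion_sum pM pf (_ : L < L + 3)%N.
have cH := cvg_half_counting_form pM pf (leq_addl L 3).
have : (-1) ^+ L * (expansion_sum (horner (p n)) L - half_counting_form (horner (p n)))
    @[n --> \oo] --> (-1) ^+ L * (expansion_sum f L - half_counting_form f).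
  apply: cvgM; first exact: cvg_cst.
  by apply: cvgB; [apply: cS; rewrite addn3 ltnW|exact: cH].
move=> /ler_cvg_to/(_ (cvg_cst 0)); apply.
by apply: nearW => n; exact: expansion_sum_horner_sign.
Qed.

Lemma expansion_bounds (f : R -> R) k : (0 < k)%N -> smooth_itv f ->
  expansion_sum f (2 * k) <= half_counting_form f <= expansion_sum f (2 * k - 1).
Proof.
move=> k0 sf; have := expansion_sum_sign (2 * k) sf.
have := expansion_sum_sign (2 * k - 1) sf.
have e : (-1) ^+ (2 * k) = 1 :> R by rewrite exprM sqrrN expr1n expr1n.
have o : (-1) ^+ (2 * k - 1) = -1 :> R.
  by case: k k0 {e} => // k _; rewrite mulnS addSn subn1/= exprS exprM sqrrN !expr1n mulr1.
by rewrite e o mulN1r oppr_le0 subr_ge0 mul1r subr_le0 => -> ->.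
Qed.

Lemma expansion_cvg (f : R -> R) : smooth_itv f ->
  cvg (expansion_sum f n @[n --> \oo]) ->
  half_counting_form f = lim (expansion_sum f n @[n --> \oo]).
Proof.
move=> sf /cvg_ex[l fl]; rewrite (cvg_lim _ fl)//.
have sub (u : nat -> nat) : (forall n, (n <= u n)%N) ->
    expansion_sum f (u n) @[n --> \oo] --> l.
  move=> un; apply: (cvg_comp _ _ _ fl).
  move=> A [N _ NA]; exists N => // n /= Nn; apply: NA => /=.
  exact: leq_trans (un n).
have he : expansion_sum f (2 * n.+1) @[n --> \oo] --> l by apply: sub => n; lia.
have ho : expansion_sum f (2 * n.+1 - 1) @[n --> \oo] --> l by apply: sub => n; lia.
apply/le_anti/andP; split.
  apply: (ler_cvg_to (cvg_cst _) ho); apply: nearW => n.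
  by have /andP[] := expansion_bounds (ltn0Sn n) sf.
apply: (ler_cvg_to he (cvg_cst _)); apply: nearW => n.
by have /andP[] := expansion_bounds (ltn0Sn n) sf.
Qed.

Lemma expansion_horner_is_cvg (p : {poly R}) :
  cvg (expansion_sum (horner p) n @[n --> \oo]).
Proof.
apply/cvg_ex; exists (half_counting_form (horner p)); apply: cvg_near_cst.
exists (size p) => // n /= pn; rewrite expansion_sum_horner_eq//.
exact: leq_trans pn (leqnSn _).
Qed.
End limit.

Theorem corollary9 (R : realType) :
  (forall k : nat, (1 <= k)%N ->
    [/\ forall phi : R -> R, smooth_itv phi ->
          \sum_(1 <= l < (2 * k).+1) expansion_term phi l
            <= 2^-1 * inner_beta (counting_op phi) phi
            <= \sum_(1 <= l < (2 * k - 1).+1) expansion_term phi l,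
        forall p : {poly R}, size p = (2 * k).+1 ->
          \sum_(1 <= l < (2 * k).+1) expansion_term (horner p) l
            = 2^-1 * inner_beta (counting_op (horner p)) (horner p)
      & forall p : {poly R}, size p = (2 * k - 1).+1 ->
          2^-1 * inner_beta (counting_op (horner p)) (horner p)
            = \sum_(1 <= l < (2 * k - 1).+1) expansion_term (horner p) l])
  /\ (forall phi : R -> R, smooth_itv phi ->
        cvg (\sum_(1 <= l < n.+1) expansion_term phi l @[n --> \oo]) ->
        2^-1 * inner_beta (counting_op phi) phi
          = lim (\sum_(1 <= l < n.+1) expansion_term phi l @[n --> \oo]))
  /\ (forall p : {poly R},
        cvg (\sum_(1 <= l < n.+1) expansion_term (horner p) l @[n --> \oo])).
Proof.
split; last by split; [exact: expansion_cvg|exact: expansion_horner_is_cvg].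
move=> k k0; split.
- by move=> phi; exact: expansion_bounds.
- by move=> p sp; apply: expansion_sum_horner_eq; rewrite sp.
- by move=> p sp; apply/esym/expansion_sum_horner_eq; rewrite sp.
Qed.
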